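(* Let $E\subset\mathbb{R}^d$ be a Moran set with $c_*=\inf_{k,j}c_{k,j}=0$. Suppose that $$\lim_{k\to+\infty}\frac{\log\underline{c}_k}{\log M_k}=0,$$ where $\underline{c}_k=\min_{1\le j\le n_k}c_{k,j}$ and $M_k=\max_{\mathbf{u}\in\Sigma^k}|J_{\mathbf{u}}|$. Then, for every $\theta\in[0,1]$, the upper and lower $\theta$-intermediate dimensions of $E$ are given by $$\overline{\dim}_\theta E=s^\theta,\qquad \underline{\dim}_\theta E=s_\theta .$$
   Context: Intermediate dimensions. $|\cdot|$ denotes the diameter of a set. For $E\subset\mathbb{R}^d$ and $0\le\theta\le1$ (with $\delta^{1/\theta}$ read as $0$ when $\theta=0$, so that both dimensions equal the Hausdorff dimension $\dim_H E$): $\underline{\dim}_\theta E=\inf\{s\ge0:$ for all $\varepsilon>0$ and $\Delta>0$ there exist $0<\delta\le\Delta$ and a cover $\{U_i\}$ of $E$ such that $\delta^{1/\theta}\le|U_i|\le\delta$ for all $i$ and $\sum|U_i|^s\le\varepsilon\}$; $\overline{\dim}_\theta E=\inf\{s\ge0:$ for all $\varepsilon>0$ there exists $\Delta>0$ such that for all $0<\delta\le\Delta$ there is a cover $\{U_i\}$ of $E$ such that $\delta^{1/\theta}\le|U_i|\le\delta$ for all $i$ and $\sum|U_i|^s\le\varepsilon\}$. Words and cut sets. Let $\{n_k\}_{k\ge1}$ be integers $\ge2$. $\Sigma^k=\{u_1\cdots u_k:1\le u_j\le n_j\}$, $\Sigma^0=\{\emptyset\}$, $\Sigma^*=\bigcup_{k\ge0}\Sigma^k$,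 $\Sigma^\infty=\{u_1u_2\cdots:1\le u_k\le n_k\}$. For $\mathbf{u}=u_1\cdots u_k\in\Sigma^*$ with $k\ge1$, $\mathbf{u}^*=u_1\cdots u_{k-1}$. A set $A\subset\Sigma^*$ is a cut set if every $\mathbf{w}\in\Sigma^\infty$ has exactly one element of $A$ as a prefix. Moran sets. Let $J\subset\mathbb{R}^d$ be compact with nonempty interior, and let $\phi_k=(c_{k,1},\dots,c_{k,n_k})$, $k\ge1$, be positive real vectors with $\sum_{j=1}^{n_k}(c_{k,j})^d\le1$. Let $\{J_{\mathbf{u}}:\mathbf{u}\in\Sigma^*\}$ be closed subsets of $J$ such that: (1) for each $\mathbf{u}$ there is a similarity $\Psi_{\mathbf{u}}:\mathbb{R}^d\to\mathbb{R}^d$ with $J_{\mathbf{u}}=\Psi_{\mathbf{u}}(J)$, and $J_\emptyset=J$; (2) for all $k\ge1$ and $\mathbf{u}\in\Sigma^{k-1}$, the sets $J_{\mathbf{u}1},\dots,J_{\mathbf{u}n_k}$ are subsets of $J_{\mathbf{u}}$ with pairwise disjoint interiors and $|J_{\mathbf{u}i}|/|J_{\mathbf{u}}|=c_{k,i}$ for $1\le i\le n_k$. Then $E=\bigcap_{k\ge1}\bigcup_{\mathbf{u}\in\Sigma^k}J_{\mathbf{u}}$ is called a Moran set. The numbers $s^\theta,s_\theta$. For $\delta>0$ and $\theta\in(0,1]$, $$s_{\delta,\theta}=\min\Big\{s:\sum_{\mathbf{u}\in\mathcal{M}}|J_{\mathbf{u}}|^s=1,\ \text{where }\mathcal{M}\text{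 is a cut set such that }\delta^{1/\theta}<|J_{\mathbf{u}^*}|\text{ and }|J_{\mathbf{u}}|\le\delta\text{ for each }\mathbf{u}\in\mathcal{M}\Big\},$$ $s^\theta=\limsup_{\delta\to0}s_{\delta,\theta}$ and $s_\theta=\liminf_{\delta\to0}s_{\delta,\theta}$. For $\theta=0$, $s^\theta=s_\theta=s_*$, where $s_*=\liminf_{m\to\infty}s_m$ and $s_m$ is the unique real solution $s$ of $\prod_{i=1}^m\big(\sum_{j=1}^{n_i}(c_{i,j})^s\big)=1$. *)

(* Defs.v *)
From HB Require Import structures.
From mathcomp Require Import all_boot all_order all_algebra.
From mathcomp Require Import all_classical all_reals all_analysis.
Set Implicit Arguments.
Unset Strict Implicit.
Unset Printing Implicit Defensive.
Import Order.TTheory GRing.Theory Num.Theory.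
Import numFieldNormedType.Exports.
Local Open Scope classical_set_scope.
Local Open Scope ring_scope.

(* The library norm on 'rV[R]_d is the sup norm, hence this definition; the
   topology (used for compact, closed, interior) is the same. *)
Definition eucl_dist (R : realType) (d : nat) (x y : 'rV[R]_d) : R :=
  Num.sqrt (\sum_(i < d) (x ord0 i - y ord0 i) ^+ 2).

(* Extended-real valued, so that unbounded sets have diameter +oo; the
   adjoined 0 only matters for the empty set. *)
Definition ediam (R : realType) (d : nat) (A : set 'rV[R]_d) : \bar R :=
  ereal_sup (0%E |` [set (eucl_dist xy.1 xy.2)%:E | xy in A `*` A]).

Definition diam (R : realType) (d : nat) (A : set 'rV[R]_d) : R :=
  fine (ediam A).

Definition similarity (R : realType) (d : nat) (f : 'rV[R]_d -> 'rV[R]_d) :=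
  exists2 r : R, 0 < r &
    forall x y, eucl_dist (f x) (f y) = r * eucl_dist x y.

(** Intermediate dimensions *)

(* delta^(1/theta), read as 0 when theta = 0 *)
Definition theta_scale (R : realType) (theta delta : R) : R :=
  if theta == 0 then 0 else delta `^ theta^-1.

(* Covers are indexed by an arbitrary D : set nat, so that both finite and
   countably infinite covers are allowed. *)
Definition theta_cover (R : realType) (d : nat) (theta s eps delta : R)
    (E : set 'rV[R]_d) : Prop :=
  exists (D : set nat) (U : nat -> set 'rV[R]_d),
    [/\ E `<=` \bigcup_(i in D) U i,
        forall i, D i ->
          ((theta_scale theta delta)%:E <= ediam (U i) <= delta%:E)%E &
        (\esum_(i in D) (ediam (U i) `^ s) <= eps%:E)%E].

Definition lower_intermediate_dim (R : realType) (d : nat) (theta : R)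
    (E : set 'rV[R]_d) : \bar R :=
  ereal_inf [set s%:E | s in [set s : R | 0 <= s /\
    forall eps Delta : R, 0 < eps -> 0 < Delta ->
      exists2 delta : R, 0 < delta <= Delta &
        theta_cover theta s eps delta E]].

Definition upper_intermediate_dim (R : realType) (d : nat) (theta : R)
    (E : set 'rV[R]_d) : \bar R :=
  ereal_inf [set s%:E | s in [set s : R | 0 <= s /\
    forall eps : R, 0 < eps ->
      exists2 Delta : R, 0 < Delta &
        forall delta : R, 0 < delta <= Delta ->
          theta_cover theta s eps delta E]].

(** Words. Positions and letters are numbered from 0: [n k], [c k j] stand for
    the usual n_(k+1), c_(k+1,j+1), and the letters at position k are the
    j < n k. *)

Definition words (n : nat -> nat) (k : nat) : set (seq nat) :=
  [set u | size u = k /\ forall i, (i < k)%N -> (nth 0 u i < n i)%N].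

Definition finite_words (n : nat -> nat) : set (seq nat) :=
  \bigcup_k words n k.

Definition infinite_words (n : nat -> nat) : set (nat -> nat) :=
  [set w | forall k, (w k < n k)%N].

Definition parent (u : seq nat) : seq nat := take (size u).-1 u.

Definition cut_set (n : nat -> nat) (A : set (seq nat)) : Prop :=
  A `<=` finite_words n /\
  forall w, infinite_words n w -> exists! u, A u /\ u = mkseq w (size u).

(** Moran sets *)

Record moran_structure (R : realType) (d : nat) (n : nat -> nat)
    (c : nat -> nat -> R) (J : seq nat -> set 'rV[R]_d) : Prop := {
  moran_branching : forall k, (2 <= n k)%N ;
  moran_ratio_gt0 : forall k j, (j < n k)%N -> 0 < c k j ;
  moran_ratio_sum : forall k, \sum_(j < n k) c k j ^+ d <= 1 ;
  moran_compact : compact (J [::]) ;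
  moran_interior : (J [::])° !=set0 ;
  moran_closed : forall u, finite_words n u ->
    closed (J u) /\ J u `<=` J [::] ;
  moran_similar : forall u, finite_words n u ->
    exists2 Psi, similarity Psi & J u = Psi @` J [::] ;
  moran_nested : forall k u i, words n k u -> (i < n k)%N ->
    J (rcons u i) `<=` J u ;
  moran_disjoint : forall k u i j, words n k u ->
    (i < n k)%N -> (j < n k)%N -> i <> j ->
    (J (rcons u i))° `&` (J (rcons u j))° = set0 ;
  moran_ratio : forall k u i, words n k u -> (i < n k)%N ->
    diam (J (rcons u i)) / diam (J u) = c k i }.

Definition moran_set (R : realType) (d : nat) (n : nat -> nat)
    (J : seq nat -> set 'rV[R]_d) : set 'rV[R]_d :=
  \bigcap_(k in [set k | (1 <= k)%N]) \bigcup_(u in words n k) J u.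

Definition min_ratio (R : realType) (n : nat -> nat) (c : nat -> nat -> R)
    (k : nat) : R :=
  \big[Num.min/c k 0]_(j < n k) c k j.

(* The supremum of a finite set *)
Definition max_diam (R : realType) (d : nat) (n : nat -> nat)
    (J : seq nat -> set 'rV[R]_d) (k : nat) : R :=
  sup [set diam (J u) | u in words n k].

(** The exponents *)

(* Cut sets are finite (compactness of the space of infinite words), so the
   finitely supported sum is the actual sum. *)
Definition cut_exponents (R : realType) (d : nat) (n : nat -> nat)
    (J : seq nat -> set 'rV[R]_d) (theta delta : R) : set R :=
  [set s : R | exists M : set (seq nat),
    [/\ cut_set n M,
        forall u, M u -> delta `^ theta^-1 < diam (J (parent u)) /\
                         diam (J u) <= delta &
        \sum_(u \in M) diam (J u) `^ s = 1]].

(* The minimum; when max_diam tends to 0 it exists for all small delta > 0, and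
   only those matter in the limits below. *)
Definition s_delta (R : realType) (d : nat) (n : nat -> nat)
    (J : seq nat -> set 'rV[R]_d) (theta delta : R) : R :=
  get [set s : R | cut_exponents n J theta delta s /\
                   lbound (cut_exponents n J theta delta) s].

(* The solution is unique when m >= 1; the value at m = 0 does not affect the
   lower limit below. *)
Definition s_level (R : realType) (n : nat -> nat) (c : nat -> nat -> R)
    (m : nat) : R :=
  get [set s : R | \prod_(i < m) (\sum_(j < n i) c i j `^ s) = 1].

Definition s_star (R : realType) (n : nat -> nat) (c : nat -> nat -> R) :
    \bar R :=
  limn_einf (fun m => (s_level n c m)%:E).

Definition s_upper (R : realType) (d : nat) (n : nat -> nat)
    (c : nat -> nat -> R) (J : seq nat -> set 'rV[R]_d) (theta : R) : \bar R :=
  if theta == 0 then s_star n c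
  else limf_esup (fun delta => (s_delta n J theta delta)%:E) 0^'+.

Definition s_lower (R : realType) (d : nat) (n : nat -> nat)
    (c : nat -> nat -> R) (J : seq nat -> set 'rV[R]_d) (theta : R) : \bar R :=
  if theta == 0 then s_star n c
  else limf_einf (fun delta => (s_delta n J theta delta)%:E) 0^'+.

(* Main.v *)
Require Import Defs.
From mathcomp Require Import all_boot all_order all_algebra.
From mathcomp Require Import all_classical all_reals all_analysis.
From mathcomp Require Import ring lra.
Import Order.TTheory GRing.Theory Num.Theory.
Import numFieldNormedType.Exports.
Local Open Scope classical_set_scope.
Local Open Scope ring_scope.
Set Implicit Arguments.
Unset Strict Implicit.
Unset Printing Implicit Defensive.

(** Write [D u] for the diameter of [J u], and let [eta > 0] be arbitrarily small.
    The hypothesis on the ratios implies that the diameters tend to 0 along the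
    tree of words ([diam_tends]) and that a small set [J u] is not much smaller
    than the set of the parent of [u]: [D (parent u) ^ (1 + eta) <= D u]
    ([diam_parent_powR_le]). Hence covers of the
    Moran set [E] by sets with diameters in a range [[tau, delta]], and cut sets
    whose words satisfy [tau < D (parent u)] and [D u <= delta], can be exchanged
    for each other up to constants and small changes of exponent.

    From a cut set to a cover ([cut_theta_cover], [cut_to_cover]): the sets [J u]
    cover [E]; those of diameter less than [tau] are enlarged to diameter [tau],
    and [tau ^ (1 + eta) <= D u], so that the exponent grows by a factor at most
    [1 + eta]. A further increase of the exponent makes the sum as small as
    desired.

    From a cover to a cut set ([cover_to_cut], [cover_cut_sum]): a set [U] of
    diameter [r] is replaced by the words [u] with [D u <= r < D (parent u)] such
    that [J u] meets [U]. The interiors of these sets are disjoint and contain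
    cubes of size comparable to [D u >= r ^ (1 + eta)], so that there are at most
    [C * r ^ (- d eta)] of them ([card_words_meeting]). Every infinite word has a
    prefix among the chosen words, and its shortest such prefixes form a cut set
    ([bar_cut_set]).

    For [theta > 0], with [tau = delta ^ (1 / theta)], the cut sets in question
    are those over which [s_delta] is a minimum, and sums over a cut set decrease
    strictly with the exponent. So [s_delta < s'] gives covers with small sums
    for every exponent above [s'], and [s < s_delta] forbids them for every
    exponent below [s]; taking limits as [delta] tends to 0 yields both
    dimensions. For [theta = 0], [tau = 0] and the sum over a cut set is compared
    with the sum over a level of the tree: covers come from the levels
    ([s_level_cover]), and since masses distributed in proportion to the powers
    of the ratios add up to 1 over every cut set ([cut_set_mass],
    [cut_sum_ge]), the sum over a cut set of long words is bounded below as soon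
    as the sums over all deep levels are. *)

(** * Words and cut sets *)

Section Words.
Variable n : nat -> nat.

Lemma words_nil : words n 0 [::].
Proof. by split. Qed.

Lemma words_rcons k u i :
  words n k.+1 (rcons u i) <-> words n k u /\ (i < n k)%N.
Proof.
split=> [[]|[[szu un] ik]].
- rewrite size_rcons => -[szu] un; split; last first.
    by have := un k (ltnSn k); rewrite nth_rcons szu ltnn eqxx.
  split=> // j jk; have := un j (ltnW jk).
  by rewrite nth_rcons szu jk.
- split; first by rewrite size_rcons szu.
  move=> j; rewrite ltnS leq_eqVlt nth_rcons szu => /predU1P[->|jk].
    by rewrite ltnn eqxx.
  by rewrite jk; exact: un.
Qed.

Fixpoint level k : seq (seq nat) :=
  if k is k'.+1 then [seq rcons u i | u <- level k', i <- iota 0 (n k')]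
  else [:: [::]].

Lemma mem_level k u : (u \in level k) <-> words n k u.
Proof.
elim: k u => [|k IH] u /=.
  rewrite inE; split=> [/eqP ->|[/size0nil -> //]]; exact: words_nil.
split=> [/allpairsP[[v i] /= [vk ik ->]]|].
  by apply/words_rcons; split; [exact/IH | move: ik; rewrite mem_iota].
case/lastP: u => [[]//|u i /words_rcons[uk ik]].
apply/allpairsP; exists (u, i); split=> //=; first exact/IH.
by rewrite mem_iota.
Qed.

Lemma size_level k u : u \in level k -> size u = k.
Proof. by move=> /mem_level[]. Qed.

Lemma level_uniq k : uniq (level k).
Proof.
elim: k => //= k IH; apply: allpairs_uniq => //; first exact: iota_uniq.
by move=> [u i] [v j] _ _ /= /rcons_inj[-> ->].
Qed.

Lemma words_mkseq w k : infinite_words n w -> words n k (mkseq w k).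
Proof.
move=> wn; split; first by rewrite size_mkseq.
by move=> i ik; rewrite nth_mkseq.
Qed.

Lemma finite_words_size u : finite_words n u -> words n (size u) u.
Proof. by case=> k _ [<- un]; split. Qed.

Lemma finite_words_rcons u i :
  finite_words n (rcons u i) -> words n (size u) u /\ (i < n (size u))%N.
Proof. by move/finite_words_size; rewrite size_rcons => /words_rcons. Qed.

Lemma mkseq_take (w : nat -> nat) k m : (k <= m)%N -> take k (mkseq w m) = mkseq w k.
Proof. by move=> km; rewrite -map_take take_iota (minn_idPl km). Qed.

Lemma prefix_mkseq u v : prefix u v -> u = mkseq (nth 0%N v) (size u).
Proof.
move=> /prefixP[t ->]; apply: (@eq_from_nth _ 0%N); rewrite ?size_mkseq// => i iu.
by rewrite nth_mkseq// nth_cat iu.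
Qed.

Hypothesis n_gt0 : forall k, (0 < n k)%N.

(** Every word is padded by zeros into an infinite one: reading a word past its
    end gives the letter 0. *)
Lemma infinite_nth u : finite_words n u -> infinite_words n (nth 0%N u).
Proof.
move=> /finite_words_size[_ un] k; have [/un//|uk] := ltnP k (size u).
by rewrite nth_default.
Qed.

Lemma cut_set_prefix M u v :
  cut_set n M -> M u -> M v -> prefix u v -> u = v.
Proof.
move=> [Mn cutM] Mu Mv uv.
have [x [_ xP]] := cutM _ (infinite_nth (Mn _ Mv)).
by transitivity x; [symmetry|]; apply: xP; split=> //;
  [exact: prefix_mkseq | rewrite mkseq_nth].
Qed.

(** Koenig's lemma: a word below which a cut set is unbounded has a child with
    the same property, since it has finitely many children, and the infinite
    word obtained in this way would meet the cut set nowhere. *)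
Lemma cut_set_bounded M : cut_set n M ->
  exists K, forall u, M u -> (size u <= K)%N.
Proof.
move=> [Mn cutM].
pose bad u := words n (size u) u /\
  forall K, exists2 v, M v /\ prefix u v & (K < size v)%N.
apply: contrapT => /forallNP unbdd.
have bad0 : bad [::].
  split=> // K; have /existsNP[u /not_implyP[Mu /negP]] := unbdd K.
  by rewrite -ltnNge => Ku; exists u; rewrite ?prefix0s.
have bad_child u : bad u -> exists i, bad (rcons u i).
  move=> [un badu]; apply: contrapT => /forallNP good.
  have {}good i : exists K, (i < n (size u))%N ->
      forall v, M v -> prefix (rcons u i) v -> (size v <= K)%N.
    have [ilt|?] := boolP (i < n (size u))%N; last by exists 0%N.
    have := good i; rewrite /bad size_rcons => /not_andP[[]|].
      exact/words_rcons.
    move=> /existsNP[K NK]; exists K => _ v Mv uv; rewrite leqNgt.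
    by apply/negP => Kv; apply: NK; exists v.
  have [f fP] := choice good.
  have [v [Mv /prefixP[[|i t] vE] szv]] :=
    badu (maxn (size u) (\max_(i < n (size u)) f i)).
    by move: szv; rewrite vE cats0 ltnNge leq_max leqnn.
  have ilt : (i < n (size u))%N.
    have [_ /(_ (size u))] := finite_words_size (Mn _ Mv).
    by rewrite vE size_cat/= -addSnnS ltn_addr// nth_cat ltnn subnn; apply.
  have /(_ ilt v Mv) := fP i; rewrite vE -cat_rcons prefix_prefix => /(_ isT).
  rewrite cat_rcons -vE leqNgt => /negP; apply; apply: leq_ltn_trans szv.
  by rewrite leq_max (leq_bigmax (Ordinal ilt)) orbT.
have /choice[next nextP] u : exists i, bad u -> bad (rcons u i).
  by have [/bad_child[i ?]|?] := pselect (bad u); [exists i | exists 0%N].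
pose path k := iter k (fun u => rcons u (next u)) [::].
pose w k := next (path k).
have pathE k : path k = mkseq w k.
  by elim: k => //= k IH; rewrite mkseqS -IH.
have badw k : bad (mkseq w k).
  by rewrite -pathE; elim: k => //= k; exact: nextP.
have wn : infinite_words n w.
  move=> k; have [+ _] := badw k.+1.
  by rewrite mkseqS size_rcons size_mkseq => /words_rcons[].
have [u [[Mu uE] _]] := cutM w wn.
have [_ /(_ (size u))] := badw (size u); rewrite -uE => -[v [Mv uv]].
by rewrite (cut_set_prefix (conj Mn cutM) Mu Mv uv) ltnn.
Qed.

Lemma bounded_words_seq (M : set (seq nat)) K : M `<=` finite_words n ->
  (forall u, M u -> (size u <= K)%N) -> exists2 s, uniq s & M = [set` s].
Proof.
move=> Mn MK.
exists [seq u <- undup (flatten [seq level k | k <- iota 0 K.+1]) | u \in M].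
  by rewrite filter_uniq ?undup_uniq.
apply/seteqP; split=> u; rewrite /mkset mem_filter mem_undup; last first.
  by case/andP => /set_mem.
move=> Mu; apply/andP; split; first exact/mem_set.
apply/flattenP; exists (level (size u)); last exact/mem_level/finite_words_size/Mn.
by apply: map_f; rewrite mem_iota ltnS MK.
Qed.

Lemma cut_set_seq M : cut_set n M -> exists2 s, uniq s & M = [set` s].
Proof.
by move=> cutM; have [K MK] := cut_set_bounded cutM;
  case: cutM => Mn _; exact: bounded_words_seq Mn MK.
Qed.

Lemma words_cut_set K : cut_set n (words n K).
Proof.
split=> [u uK|w wn]; first by exists K.
exists (mkseq w K); split; first by rewrite size_mkseq; split=> //; exact: words_mkseq.
by move=> u [[szu _] uE]; rewrite uE szu.
Qed.

Lemma cut_set_nonempty M : cut_set n M -> M !=set0.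
Proof.
move=> [_ cutM]; have [u [[Mu _] _]] := cutM (fun=> 0%N) n_gt0.
by exists u.
Qed.

(** Among the prefixes of an infinite word that lie in [W], keep the shortest. *)
Lemma bar_cut_set W : W `<=` finite_words n ->
  (forall w, infinite_words n w -> exists k, W (mkseq w k)) ->
  exists2 M, cut_set n M & M `<=` W.
Proof.
move=> Wn barW.
exists [set u | W u /\ forall k, (k < size u)%N -> ~ W (take k u)]; last first.
  by move=> u [].
split=> [u [/Wn]//|w wn].
have ex : exists k, `[< W (mkseq w k) >] by have [k ?] := barW w wn; exists k; exact/asboolP.
case: (ex_minnP ex) => k /asboolP Wk mink.
have ltN j : (j < k)%N -> ~ W (mkseq w j).
  by move=> jk /asboolP /mink; rewrite leqNgt jk.
exists (mkseq w k); split.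
  split; last by rewrite size_mkseq.
  by split=> // j; rewrite size_mkseq => jk; rewrite mkseq_take ?(ltnW jk)//; exact: ltN.
move=> u [[Wu minu] uE].
suff -> : k = size u by [].
have [uk|ku|//] := ltngtP (size u) k.
- by have := ltN _ uk; rewrite -uE.
- by have := minu _ ku; rewrite uE mkseq_take ?(ltnW ku).
Qed.

Lemma sum_level_prefix (V : nmodType) (mu : seq nat -> V) u k K :
  (forall k u, words n k u -> \sum_(i < n k) mu (rcons u i) = mu u) ->
  words n k u -> (k <= K)%N ->
  \sum_(v <- level K | prefix u v) mu v = mu u.
Proof.
move=> additive uk; elim: K => [|K IH].
  rewrite leqn0 => /eqP k0; move: uk; rewrite {}k0 => -[/size0nil -> _].
  by rewrite /= big_mkcond big_seq1.
rewrite leq_eqVlt => /predU1P[kK|]; last first.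
  rewrite ltnS => kK; rewrite -[RHS](IH kK) /= big_mkcond big_allpairs_dep.
  rewrite [RHS]big_mkcond; apply: eq_big_seq => v vK.
  have [vn _] := (mem_level K v).1 vK; have [un _] := uk.
  have pE i : prefix u (rcons v i) = prefix u v.
    by rewrite !prefixE -cats1 takel_cat // un vn.
  under eq_bigr do rewrite pE.
  have [puv|puv] := boolP (prefix u v); last by rewrite big1.
  rewrite -(additive K v); last exact/mem_level.
  by rewrite -(big_mkord xpredT (fun i => mu (rcons v i))) /index_iota subn0.
rewrite {}kK in uk *; rewrite (big_rem u); last exact/mem_level.
rewrite prefix_refl big_seq_cond big1 ?Monoid.mulm1// => v /andP[vr uv].
move: vr; rewrite (rem_filter _ (level_uniq _)) mem_filter => /andP[/= /eqP vu vK].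
case: vu; move: uv; rewrite prefixE (proj1 uk) -(@size_level K.+1 v vK) take_size.
by move/eqP.
Qed.

(** A finitely additive mass on words gives every cut set the mass of the empty
    word: far enough down the tree, each word of a given length extends exactly
    one element of the cut set. *)
Lemma cut_set_mass (V : nmodType) (mu : seq nat -> V) (s : seq (seq nat)) :
  (forall k u, words n k u -> \sum_(i < n k) mu (rcons u i) = mu u) ->
  uniq s -> cut_set n [set` s] -> \sum_(u <- s) mu u = mu [::].
Proof.
move=> additive us cuts; have [K sK] := cut_set_bounded cuts.
rewrite -(sum_level_prefix additive words_nil (leq0n K)).
transitivity (\sum_(u <- s) \sum_(v <- level K | prefix u v) mu v).
  apply: eq_big_seq => u us'; symmetry.
  by apply: sum_level_prefix additive (finite_words_size _) (sK _ _) => //;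
    case: cuts => /(_ u us').
rewrite (exchange_big_dep xpredT) //= [LHS]big_seq_cond [RHS]big_seq_cond.
apply: eq_big => [v|v]; rewrite ?prefix0s// andbT => vK.
have vn : finite_words n v by exists K => //; exact/mem_level.
have [u [[/= us' uE] uU]] := (proj2 cuts) _ (infinite_nth vn).
have uv : prefix u v.
  have uv : (size u <= size v)%N by rewrite (size_level vK) sK.
  by rewrite prefixE uE size_mkseq -(mkseq_take _ uv) mkseq_nth.
rewrite (big_rem u) //= uv big_seq_cond big1 ?addr0// => u' /andP[].
rewrite rem_filter// mem_filter => /andP[/= /eqP u'u u's] u'v; case: u'u.
by rewrite (uU u')//; split=> //; exact: prefix_mkseq.
Qed.

End Words.

(** * Finite sums *)

Lemma seq_argmax (R : realType) (T : eqType) (f : T -> R) (s : seq T) : s != [::] ->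
  exists2 x, x \in s & forall y, y \in s -> f y <= f x.
Proof.
elim: s => // x [|x' s] IH _.
  by exists x; rewrite ?mem_head// => y; rewrite inE => /eqP ->.
have [//|z zs zmax] := IH; have [xz|zx] := leP (f x) (f z).
  by exists z => [|y]; rewrite inE ?zs ?orbT// => /predU1P[->//|/zmax].
exists x; rewrite ?mem_head// => y; rewrite inE => /predU1P[->//|/zmax/le_trans].
by apply; exact: ltW.
Qed.

Lemma sum_partition_seq (R : realType) (T : eqType) (s : seq T) (f : T -> nat) (F : T -> R) :
  \sum_(u <- s) F u = \sum_(i <- undup (map f s)) \sum_(u <- s | f u == i) F u.
Proof.
rewrite (exchange_big_dep xpredT)//= big_seq [RHS]big_seq; apply: eq_bigr => u us.
under eq_bigl do rewrite eq_sym.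
by rewrite -big_filter filter_pred1_uniq ?undup_uniq ?mem_undup ?map_f// big_seq1.
Qed.

Section ExponentialSums.
Variable R : realType.

Lemma powR_lt1_anti (a s t : R) : 0 < a < 1 -> s < t -> a `^ t < a `^ s.
Proof.
move=> /andP[a0 a1] st; rewrite /powR (gt_eqF a0) ltr_expR.
by rewrite ltr_nM2r// ln_lt0// a0 a1.
Qed.

Lemma powR_continuous (a : R) : 0 < a -> continuous (fun s => a `^ s).
Proof.
move=> a0 s; rewrite /powR gt_eqF//.
apply: (@cvg_comp _ _ _ ( *%R^~ (ln a)) expR _ (nbhs (s * ln a))).
  by apply: cvgM; [exact: cvg_id|exact: cvg_cst].
exact: continuous_expR.
Qed.

Lemma powR_small (zeta e : R) : 0 < zeta -> 0 < e ->
  exists2 delta, 0 < delta & forall x, 0 < x <= delta -> x `^ zeta <= e.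
Proof.
move=> z0 e0; exists (e `^ zeta^-1); first exact: powR_gt0.
move=> x /andP[x0 xe]; rewrite -[leRHS]powRr1 ?(ltW e0)//.
rewrite -(mulVf (lt0r_neq0 z0)) powRrM.
by rewrite ge0_ler_powR ?nnegrE ?powR_ge0 ?(ltW x0) ?(ltW z0).
Qed.

Variables (I : eqType) (r : seq I) (a : I -> R).
Hypothesis a01 : forall i, i \in r -> 0 < a i < 1.

Lemma exp_sum_continuous : continuous (fun s => \sum_(i <- r) a i `^ s).
Proof.
elim: r a01 => [|i r' IH] air s.
  by under eq_fun do rewrite big_nil; exact: cvg_cst.
under eq_fun do rewrite big_cons.
apply: cvgD; last by apply: IH => j jr'; rewrite air// inE jr' orbT.
by apply: powR_continuous; case/andP: (air i (mem_head _ _)).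
Qed.

Lemma exp_sum_anti (s t : R) : r != [::] -> s < t ->
  \sum_(i <- r) a i `^ t < \sum_(i <- r) a i `^ s.
Proof.
case: r a01 => // i r' ai _ st; rewrite !big_cons ltr_leD//.
  by apply: powR_lt1_anti => //; rewrite ai ?mem_head.
rewrite big_seq [leRHS]big_seq ler_sum// => j jr'.
by rewrite ltW// powR_lt1_anti// ai// inE jr' orbT.
Qed.

Lemma exp_sum_root : r != [::] -> exists s, \sum_(i <- r) a i `^ s = 1.
Proof.
move=> r0; pose N : R := (size r)%:R.
have N0 : 0 < N by rewrite ltr0n lt0n size_eq0.
have N1 : 1 <= N by rewrite ler1n lt0n size_eq0.
(* a i `^ bnd i = N^-1, so that the sum of the bounds is an exponent at which
   each of the N terms is at most N^-1. *)
pose bnd i := ln N / - ln (a i).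
have bnd0 i : i \in r -> 0 <= bnd i.
  by move=> ir; rewrite divr_ge0 ?ln_ge0// oppr_ge0 ltW// ln_lt0// a01.
pose b := \sum_(i <- r) bnd i.
have b0 : 0 <= b by rewrite /b big_seq sumr_ge0.
have small i : i \in r -> a i `^ b <= N^-1.
  move=> ir; have /andP[ai0 ai1] := a01 ir.
  have -> : N^-1 = a i `^ (bnd i).
    rewrite /powR gt_eqF// /bnd invrN mulrN mulNr divfK; last first.
      by rewrite lt_eqF// ln_lt0 ?a01.
    by rewrite expRN lnK.
  apply: ger_powR; first by rewrite ai0 ltW.
  rewrite /b (big_rem i)//= lerDl big_seq sumr_ge0// => j /mem_rem; exact: bnd0.
pose f s := \sum_(i <- r) a i `^ s.
have f0 : f 0 = N.
  rewrite /f; under eq_bigr do rewrite powRr0.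
  by rewrite big_const_seq count_predT iter_addr addr0.
have fb : f b <= 1.
  rewrite -(mulfV (lt0r_neq0 N0)).
  have -> : N / N = \sum_(i <- r) N^-1.
    by rewrite big_const_seq count_predT iter_addr addr0 -[RHS]mulr_natl.
  by rewrite /f big_seq [leRHS]big_seq ler_sum.
have [||s _ fs1] := @IVT _ f 0 b 1 b0; last by exists s.
- by apply: continuous_subspaceT; exact: exp_sum_continuous.
- by rewrite ge_min fb orbT le_max f0 N1.
Qed.

Lemma exp_sum_ge0 (s : R) : r != [::] -> \sum_(i <- r) a i `^ s = 1 -> 0 <= s.
Proof.
move=> r0 f1; rewrite leNgt; apply/negP => s_lt0.
have := exp_sum_anti r0 s_lt0; rewrite f1 ltNge => /negP; apply.
under eq_bigr do rewrite powRr0.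
rewrite big_const_seq count_predT iter_addr addr0.
by rewrite (ler_nat _ 1) lt0n size_eq0.
Qed.

End ExponentialSums.

(** * Euclidean geometry *)

Section Euclidean.
Variables (R : realType) (d : nat).
Implicit Types (x y z p : 'rV[R]_d) (A : set 'rV[R]_d).

Lemma sqr_eucl_dist x y :
  eucl_dist x y ^+ 2 = \sum_(i < d) (x ord0 i - y ord0 i) ^+ 2.
Proof. by rewrite sqr_sqrtr// sumr_ge0// => i _; exact: sqr_ge0. Qed.

Lemma eucl_dist_ge0 x y : 0 <= eucl_dist x y.
Proof. exact: sqrtr_ge0. Qed.

Lemma eucl_distC x y : eucl_dist x y = eucl_dist y x.
Proof.
by congr Num.sqrt; apply: eq_bigr => i _; rewrite -sqrrN opprB.
Qed.

Lemma coord_le_eucl_dist x y i : `|x ord0 i - y ord0 i| <= eucl_dist x y.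
Proof.
rewrite -(@ler_pXn2r _ 2)// ?nnegrE ?eucl_dist_ge0// sqr_eucl_dist.
rewrite (bigD1 i)//= real_normK ?num_real// lerDl sumr_ge0// => j _.
exact: sqr_ge0.
Qed.

Lemma eucl_dist_le_coord x y (h : R) : 0 <= h ->
  (forall i, `|x ord0 i - y ord0 i| <= h) -> eucl_dist x y <= d%:R * h.
Proof.
move=> h0 xy; rewrite -(@ler_pXn2r _ 2)// ?nnegrE ?eucl_dist_ge0 ?mulr_ge0//.
rewrite sqr_eucl_dist; apply: (@le_trans _ _ (\sum_(i < d) h ^+ 2)).
  apply: ler_sum => i _; rewrite -[leLHS]real_normK ?num_real//.
  by rewrite ler_pXn2r// nnegrE.
rewrite sumr_const card_ord exprMn -[leLHS]mulr_natl ler_wpM2r ?sqr_ge0//.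
by rewrite -natrX ler_nat; case: (d) => // k; rewrite expnS leq_pmulr// expn_gt0.
Qed.

(** A map that multiplies distances by [r] multiplies inner products of
    differences by [r ^ 2] (polarization), so the images of the basis vectors
    form, up to the factor [r], an orthogonal matrix; its rows span the space. *)
Lemma similarity_surjective (f : 'rV[R]_d -> 'rV[R]_d) (r : R) : 0 < r ->
  (forall x y, eucl_dist (f x) (f y) = r * eucl_dist x y) ->
  forall y, exists x, f x = y.
Proof.
move=> r0 fr y; pose g x := f x - f 0.
have sq_fr u v : \sum_(i < d) (f u ord0 i - f v ord0 i) ^+ 2 =
    r ^+ 2 * \sum_(i < d) (u ord0 i - v ord0 i) ^+ 2.
  by rewrite -!sqr_eucl_dist fr exprMn.
have dot_g u v : \sum_(i < d) g u ord0 i * g v ord0 i =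
    r ^+ 2 * \sum_(i < d) u ord0 i * v ord0 i.
  have polar (a b c : 'rV[R]_d) :
      (\sum_(i < d) (a ord0 i - c ord0 i) * (b ord0 i - c ord0 i)) *+ 2 =
      \sum_(i < d) (a ord0 i - c ord0 i) ^+ 2 +
      \sum_(i < d) (b ord0 i - c ord0 i) ^+ 2 -
      \sum_(i < d) (a ord0 i - b ord0 i) ^+ 2.
    rewrite -sumrMnl -big_split/= -sumrB; apply: eq_bigr => i _; ring.
  apply: (@mulIf _ 2%:R); first by rewrite pnatr_eq0.
  rewrite -mulrA !mulr_natr.
  transitivity ((\sum_(i < d) (f u ord0 i - f 0 ord0 i) *
                  (f v ord0 i - f 0 ord0 i)) *+ 2).
    by congr (_ *+ 2); apply: eq_bigr => i _; rewrite !mxE.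
  rewrite polar !sq_fr -mulrDr -mulrBr -polar; congr (_ * (_ *+ _)).
  by apply: eq_bigr => i _; rewrite !mxE !subr0.
have r2 : r ^+ 2 != 0 by rewrite expf_neq0 ?gt_eqF.
pose A : 'M[R]_d := \matrix_(i, j) g (delta_mx ord0 i) ord0 j.
have gA u : g u *m A^T = r ^+ 2 *: u.
  apply/matrixP => i j; rewrite ord1 !mxE.
  under eq_bigr do rewrite !mxE.
  transitivity (\sum_k g u ord0 k * g (delta_mx ord0 j) ord0 k).
    by apply: eq_bigr => k _; rewrite !mxE.
  rewrite dot_g; congr (_ * _); rewrite (bigD1 j)//= big1 ?addr0.
    by rewrite mxE !eqxx mulr1.
  by move=> k kj; rewrite mxE (negbTE kj) andbF mulr0.
have AAt : A *m A^T = (r ^+ 2)%:M.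
  apply/row_matrixP => i; rewrite row_mul.
  have -> : row i A = g (delta_mx ord0 i) by apply/matrixP => a b; rewrite ord1 !mxE.
  by rewrite gA; apply/matrixP => a b; rewrite (ord1 a) !mxE eqxx mulr_natr eq_sym.
have AtA : A^T *m (r ^- 2 *: A) = 1%:M.
  apply: mulmx1C; rewrite -scalemxAl AAt scale_scalar_mx.
  by rewrite mulVf.
exists (r ^- 2 *: (y - f 0) *m A^T).
apply: (addIr (- f 0)); rewrite -/(g _).
set x := _ *m A^T.
rewrite -[g x]mulmx1 -AtA mulmxA gA -scalemxAl -scalemxAr scalerA divff//.
rewrite scale1r /x -!scalemxAl -mulmxA scalemxAr.
by rewrite scalemxAr AtA mulmx1.
Qed.

(** Coordinates and Euclidean distance compare up to a factor [d]; the extra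
    factor 2 leaves room for a whole cube around [y] in the image. *)
Lemma interior_similarity (f : 'rV[R]_d -> 'rV[R]_d) (r e : R) A x : 0 < r ->
  (forall x y, eucl_dist (f x) (f y) = r * eucl_dist x y) ->
  (forall y, (forall i, `|x ord0 i - y ord0 i| < e) -> A y) -> 0 < e ->
  forall y, (forall i, `|f x ord0 i - y ord0 i| <= r * e / (d.+1%:R *+ 2)) ->
    (f @` A)° y.
Proof.
move=> r0 fr Ax e0 y xy; set h := r * e / _ in xy.
have h0 : 0 < h by rewrite divr_gt0 ?mulr_gt0// pmulrn_lgt0.
apply/nbhs_ballP; exists h => //= z yz.
have {yz}xz i : `|f x ord0 i - z ord0 i| <= h *+ 2.
  have -> : f x ord0 i - z ord0 i =
    (f x ord0 i - y ord0 i) + (y ord0 i - z ord0 i) by ring.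
  rewrite (le_trans (ler_normD _ _))// mulr2n lerD// ltW//.
  by have := yz.2 ord0 i; rewrite -ball_normE.
have [w wz] := similarity_surjective r0 fr z; exists w => //; apply: Ax => i.
apply: le_lt_trans (coord_le_eucl_dist _ _ _) _.
rewrite -(ltr_pM2l r0) -fr wz.
apply: (le_lt_trans (eucl_dist_le_coord _ xz)); first by rewrite mulrn_wge0 ?ltW.
have hE : h * (d.+1%:R *+ 2) = r * e by rewrite /h divfK// mulrn_eq0/= pnatr_eq0.
rewrite -hE -natr1 !mulr2n; nra.
Qed.

(** A substitute for comparing volumes: each of the disjoint sets contains a
    point of the grid of mesh [h], and a cube of side [2 * L] contains at most
    [(2 * L / h + 1) ^ d] points of that grid. *)
Lemma card_disjoint_le (T : eqType) (s : seq T) (S : T -> set 'rV[R]_d)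
    (x : T -> 'rV[R]_d) p (h L : R) : uniq s -> 0 < h -> 0 <= L ->
  (forall v w, v \in s -> w \in s -> v != w -> S v `&` S w = set0) ->
  (forall w y, w \in s -> (forall i, `|x w ord0 i - y ord0 i| <= h) -> S w y) ->
  (forall w y, w \in s -> S w y -> forall i, `|y ord0 i - p ord0 i| <= L) ->
  (size s)%:R <= (L *+ 2 / h + 1) ^+ d.
Proof.
move=> us h0 L0 disj inS SL.
have xS w : w \in s -> S w (x w).
  by move=> ws; apply: inS => // i; rewrite subrr normr0 ltW.
pose t w i := Num.truncn ((x w ord0 i - (p ord0 i - L)) / h).
pose K := Num.truncn (L *+ 2 / h).
have t0 w i : w \in s -> 0 <= (x w ord0 i - (p ord0 i - L)) / h.
  move=> ws; rewrite divr_ge0 ?(ltW h0)//.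
  by have := SL w _ ws (xS w ws) i; rewrite ler_norml => /andP[]; lra.
have tK w i : w \in s -> (t w i <= K)%N.
  move=> ws; apply: le_truncn; rewrite ler_pM2r ?invr_gt0//.
  by have := SL w _ ws (xS w ws) i; rewrite ler_norml mulr2n => /andP[]; lra.
pose grid w := \row_i (p ord0 i - L + h * (t w i)%:R) : 'rV[R]_d.
have gridS w : w \in s -> S w (grid w).
  move=> ws; apply: inS => // i; rewrite mxE.
  have /andP[] := truncn_itv (t0 w i ws); rewrite -/(t w i) ler_pdivlMr// ltr_pdivrMr//.
  rewrite -natr1 mulrDl mul1r => t1 t2; rewrite ler_norml; apply/andP; split; lra.
pose code w : {ffun 'I_d -> 'I_K.+1} := [ffun i => inord (t w i)].
have code_inj : {in s &, injective code}.
  move=> v w vs ws /ffunP vw; apply/eqP/negP => /negP neq_vw.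
  have : (S v `&` S w) (grid v).
    split; first exact: gridS.
    suff -> : grid v = grid w by exact: gridS.
    apply/matrixP => i j; rewrite !mxE.
    by have := vw j; rewrite !ffunE => /(congr1 (@nat_of_ord _)); rewrite !inordK ?ltnS ?tK// => ->.
  by rewrite disj.
have : (size s <= K.+1 ^ d)%N.
  rewrite -[X in (_ <= _ ^ X)%N](card_ord d) -[K.+1]card_ord -card_ffun.
  rewrite -(size_map code) -(card_uniqP _) ?map_inj_in_uniq//.
  exact: max_card.
rewrite -(ler_nat R) natrX => /le_trans; apply.
have Lh0 : 0 <= L *+ 2 / h by rewrite divr_ge0 ?mulrn_wge0 ?(ltW h0).
apply: lerXn2r; first by rewrite nnegrE ler0n.
  by rewrite nnegrE addr_ge0.
by rewrite -natr1 lerD2r truncn_le.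
Qed.

Lemma ediam_ge0 A : (0 <= ediam A)%E.
Proof. by apply: ereal_sup_ubound; left. Qed.

Lemma ediam_le A (t : R) : 0 <= t ->
  (forall x y, A x -> A y -> eucl_dist x y <= t) -> (ediam A <= t%:E)%E.
Proof.
move=> t0 At; apply: ge_ereal_sup => _ [->|[[x y] [/= Ax Ay] <-]]; rewrite lee_fin//.
exact: At.
Qed.

Lemma ediam_ub A x y : A x -> A y -> ((eucl_dist x y)%:E <= ediam A)%E.
Proof. by move=> Ax Ay; apply: ereal_sup_ubound; right; exists (x, y). Qed.

Lemma ediam_fin A (t : R) : (ediam A <= t%:E)%E -> ediam A = (diam A)%:E.
Proof.
move=> At; rewrite /diam fineK// ge0_fin_numE ?ediam_ge0//.
exact: le_lt_trans At (ltry _).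
Qed.

Lemma diam_ge0 A : 0 <= diam A.
Proof. exact/fine_ge0/ediam_ge0. Qed.

Lemma ediam_diam A : 0 < diam A -> ediam A = (diam A)%:E.
Proof.
by rewrite /diam; case: (ediam A) => //=; rewrite ltxx.
Qed.

Lemma diam_ub A x y : 0 < diam A -> A x -> A y -> eucl_dist x y <= diam A.
Proof. by move=> A0 Ax Ay; rewrite -lee_fin -ediam_diam// ediam_ub. Qed.

(** Add a segment issued from a point of [A], as long as the distance to [A]
    stays at most [tau]. *)
Lemma ediam_enlarge A (tau : R) : (0 < d)%N -> A !=set0 -> (ediam A <= tau%:E)%E ->
  exists2 U, A `<=` U & ediam U = tau%:E.
Proof.
move=> d0 [a Aa] Atau.
have tau0 : 0 <= tau by rewrite -lee_fin (le_trans (ediam_ge0 A)).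
have A_le x y : A x -> A y -> eucl_dist x y <= tau.
  by move=> Ax Ay; rewrite -lee_fin (le_trans (ediam_ub Ax Ay)).
pose k := Ordinal d0.
pose q (r : R) := a + r *: delta_mx ord0 k.
have q_le r r' y : eucl_dist (q r) y <= eucl_dist (q r') y + `|r - r'|.
  rewrite -(@ler_pXn2r _ 2)// ?nnegrE ?eucl_dist_ge0 ?addr_ge0 ?eucl_dist_ge0//.
  rewrite sqrrD real_normK ?num_real// !sqr_eucl_dist (bigD1 k)//= [in leRHS](bigD1 k)//=.
  have -> : \sum_(i < d | i != k) (q r ord0 i - y ord0 i) ^+ 2 =
            \sum_(i < d | i != k) (q r' ord0 i - y ord0 i) ^+ 2.
    by apply: eq_bigr => i ik; rewrite !mxE (negbTE ik) andbF !mulr0.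
  have key : (r - r') * (q r' ord0 k - y ord0 k) <= `|r - r'| * eucl_dist (q r') y.
    apply: le_trans (ler_norm _) _; rewrite normrM.
    by rewrite ler_wpM2l// coord_le_eucl_dist.
  have -> : q r ord0 k - y ord0 k = (q r' ord0 k - y ord0 k) + (r - r').
    by rewrite !mxE !eqxx !mulr1; ring.
  rewrite sqrrD mulr2n; lra.
have qq r r' : eucl_dist (q r) (q r') = `|r - r'|.
  rewrite /eucl_dist (bigD1 k)//= big1 ?addr0 => [|i ik]; last first.
    by rewrite !mxE (negbTE ik) andbF !mulr0 subrr expr0n.
  by rewrite !mxE !eqxx !mulr1 addrAC opprD addrA subrr add0r addrC sqrtr_sqr addrC.
have q0 : q 0 = a by rewrite /q scale0r addr0.
pose S := [set r : R | 0 <= r /\ forall y, A y -> eucl_dist (q r) y <= tau].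
have S0 : S 0 by split=> // y Ay; rewrite q0 A_le.
have S_le r : S r -> r <= tau.
  move=> [r0 Sr]; have := Sr _ Aa; rewrite -{1}q0 qq subr0 ger0_norm//.
have supS : has_sup S by split; [exists 0 | exists tau => r /S_le].
pose U := A `|` q @` S; exists U; first by move=> x; left.
have U_le : (ediam U <= tau%:E)%E.
  apply: ediam_le => // x y [Ax|[r Sr <-]] [Ay|[r' Sr' <-]].
  - exact: A_le.
  - by rewrite eucl_distC; exact: (proj2 Sr').
  - exact: (proj2 Sr).
  - rewrite qq ler_norml.
    by have := S_le _ Sr; have := S_le _ Sr'; case: Sr; case: Sr' => *; lra.
apply/eqP; rewrite eq_le U_le /= (ediam_fin U_le) lee_fin leNgt; apply/negP => Ult.
pose h := (tau - diam U) / 2.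
have h0 : 0 < h by rewrite divr_gt0// subr_gt0.
have sup0 : 0 <= sup S by apply: ub_le_sup => //; case: supS.
have [r Sr rsup] := sup_adherent h0 supS.
have [y Ay ylt] : exists2 y, A y & tau < eucl_dist (q (sup S + h / 2)) y.
  apply: contrapT => Ny; suff /(ub_le_sup (proj2 supS)) : S (sup S + h / 2) by lra.
  split=> [|y Ay]; first by lra.
  by rewrite leNgt; apply/negP => ylt; apply: Ny; exists y.
have rs : r <= sup S by apply: ub_le_sup => //; case: supS.
have : eucl_dist (q r) y <= diam U.
  rewrite -lee_fin -(ediam_fin U_le); apply: ediam_ub; last by left.
  by right; exists r.
have := q_le (sup S + h / 2) r y.
rewrite ger0_norm; last by lra.
have : tau - diam U = h * 2 by rewrite /h divfK.
lra.
Qed.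

End Euclidean.

(** * Diameters *)

Section Sizes.
Variables (R : realType) (d : nat) (n : nat -> nat) (c : nat -> nat -> R).
Variable J : seq nat -> set 'rV[R]_d.
Hypothesis moranJ : moran_structure n c J.

Local Notation D u := (diam (J u)).

Lemma moran_branching_gt0 k : (0 < n k)%N.
Proof. by rewrite (ltn_trans _ (moran_branching moranJ k)). Qed.
Let n_gt0 := moran_branching_gt0.

Lemma moran_diam0_gt0 : 0 < D [::].
Proof.
have := moran_ratio_gt0 moranJ (n_gt0 0).
rewrite -(moran_ratio moranJ (words_nil n) (n_gt0 0)) => r0.
rewrite lt0r diam_ge0 andbT.
by apply/negP => /eqP D0; rewrite D0 invr0 mulr0 ltxx in r0.
Qed.

Definition word_ratio (u : seq nat) : R := \prod_(k < size u) c k (nth 0%N u k).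

Lemma word_ratio_rcons u i :
  word_ratio (rcons u i) = word_ratio u * c (size u) i.
Proof.
rewrite /word_ratio size_rcons big_ord_recr/=; congr (_ * _).
  by apply: eq_bigr => k _; rewrite nth_rcons ltn_ord.
by rewrite nth_rcons ltnn eqxx.
Qed.

Lemma word_ratio_gt0 u : finite_words n u -> 0 < word_ratio u.
Proof.
move=> /finite_words_size[_ un]; apply: prodr_gt0 => k _.
by apply: (moran_ratio_gt0 moranJ); exact: un.
Qed.

Lemma diam_word u : finite_words n u -> D u = D [::] * word_ratio u.
Proof.
elim/last_ind: u => [_|u i IH]; first by rewrite /word_ratio big_ord0 mulr1.
move=> /finite_words_rcons[un iu].
have uw : finite_words n u by exists (size u).
rewrite word_ratio_rcons mulrA -IH// -(moran_ratio moranJ un iu) mulrC divfK//.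
by rewrite IH// mulf_neq0// gt_eqF ?moran_diam0_gt0 ?word_ratio_gt0.
Qed.

Lemma diam_gt0 u : finite_words n u -> 0 < D u.
Proof.
by move=> uw; rewrite diam_word// mulr_gt0 ?moran_diam0_gt0 ?word_ratio_gt0.
Qed.

Lemma diam_rcons u i : finite_words n (rcons u i) ->
  D (rcons u i) = D u * c (size u) i.
Proof.
move=> uw; have [un iu] := finite_words_rcons uw.
by rewrite (diam_word uw) (@diam_word u) ?word_ratio_rcons ?mulrA//; exists (size u).
Qed.

(** In dimension 0 the powers of the ratios would add up to [n 0 >= 2]. *)
Lemma moran_dim_gt0 : (0 < d)%N.
Proof.
rewrite lt0n; apply/negP => /eqP d0; have := moran_ratio_sum moranJ 0.
rewrite d0; under eq_bigr do rewrite expr0.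
by rewrite sumr_const card_ord leNgt (ltr_nat _ 1) (moran_branching moranJ).
Qed.

Lemma moran_ratio_lt1 k j : (j < n k)%N -> c k j < 1.
Proof.
move=> jn; have [i [iN ij]] : exists i, (i < n k)%N /\ i != j.
  have n2 := moran_branching moranJ k.
  by case: (j) => [|j']; [exists 1%N | exists 0%N; split => //; exact: ltnW].
have c0 l : (l < n k)%N -> 0 < c k l ^+ d.
  by move=> ln; rewrite exprn_gt0// (moran_ratio_gt0 moranJ).
rewrite -(@expr_lt1 _ d) ?moran_dim_gt0 ?ltW ?(moran_ratio_gt0 moranJ)//.
apply: lt_le_trans (moran_ratio_sum moranJ k).
rewrite (bigD1 (Ordinal jn))//= (bigD1 (Ordinal iN))//= ltrDl ltr_pwDl ?c0//.
by rewrite sumr_ge0// => l _; exact/ltW/c0.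
Qed.

Lemma word_ratio_lt1 u : finite_words n u -> u != [::] -> word_ratio u < 1.
Proof.
elim/last_ind: u => // u i IH uw _; have [un iu] := finite_words_rcons uw.
have uw' : finite_words n u by exists (size u).
have r1 : word_ratio u <= 1.
  have [->|u0] := eqVneq u [::]; first by rewrite /word_ratio big_ord0.
  exact/ltW/IH.
rewrite word_ratio_rcons (le_lt_trans (ler_wpM2r _ r1))//.
  by rewrite ltW// (moran_ratio_gt0 moranJ).
by rewrite mul1r moran_ratio_lt1.
Qed.

Lemma diam_rcons_lt u i : finite_words n (rcons u i) -> D (rcons u i) < D u.
Proof.
move=> uw; have [un iu] := finite_words_rcons uw.
by rewrite diam_rcons// gtr_pMr ?moran_ratio_lt1// diam_gt0//; exists (size u).
Qed.

Lemma parent_rcons u i : parent (rcons u i) = u.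
Proof. by rewrite /parent size_rcons -cats1 take_size_cat. Qed.

Lemma min_ratio_le k j : (j < n k)%N -> min_ratio n c k <= c k j.
Proof. by move=> jn; exact: (bigmin_le _ (Ordinal jn)). Qed.

Lemma min_ratio_gt0 k : 0 < min_ratio n c k.
Proof.
apply/bigmin_gtP; split; first exact: (moran_ratio_gt0 moranJ).
by move=> j _; exact: (moran_ratio_gt0 moranJ).
Qed.

(** Two ratios at least equal to the smallest one fit in a sum at most 1. *)
Lemma ln_min_ratio_le k : ln (min_ratio n c k) <= - (ln 2 / d%:R).
Proof.
have d0 : 0 < d%:R :> R by rewrite ltr0n moran_dim_gt0.
have m0 := min_ratio_gt0 k.
have m2 : min_ratio n c k ^+ d *+ 2 <= 1.
  apply: le_trans (moran_ratio_sum moranJ k).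
  apply: (@le_trans _ _ (\sum_(j < n k) min_ratio n c k ^+ d)).
    rewrite sumr_const card_ord -[leRHS]mulr_natl -[leLHS]mulr_natl ler_wpM2r//.
      by rewrite exprn_ge0// ltW.
    by rewrite ler_nat (moran_branching moranJ).
  by apply: ler_sum => j _; rewrite lerXn2r ?nnegrE ?min_ratio_le// ltW//
    (moran_ratio_gt0 moranJ).
rewrite lerNr ler_pdivrMr// mulNr.
have : ln (min_ratio n c k ^+ d * 2) <= 0 by rewrite ln_le0// mulr_natr.
rewrite lnM ?posrE ?exprn_gt0// lnXn// -mulr_natr; lra.
Qed.

Lemma max_diam_attained k : exists2 u, words n k u & max_diam n J k = D u.
Proof.
have lev0 : level n k != [::].
  apply/eqP => lev0; have : mkseq (fun=> 0%N) k \in level n k.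
    exact/mem_level/words_mkseq.
  by rewrite lev0.
have [u /mem_level uk umax] := seq_argmax (fun u => D u) lev0.
have ubD : ubound [set D v | v in words n k] (D u).
  by move=> _ [v vk <-]; apply: umax; exact/mem_level.
exists u => //; apply/eqP; rewrite eq_le; apply/andP; split.
  by apply: ge_sup => //; exists (D u), u.
by apply: ub_le_sup; [exists (D u) | exists u].
Qed.

Lemma diam_le_max k u : words n k u -> D u <= max_diam n J k.
Proof.
move=> uk; have lev0 : level n k != [::].
  by apply/eqP => lev0; have /mem_level := uk; rewrite lev0.
have [v /mem_level vk vmax] := seq_argmax (fun u => D u) lev0.
apply: ub_le_sup; last by exists u.
by exists (D v) => _ [w wk <-]; apply: vmax; exact/mem_level.
Qed.

Lemma max_diam_gt0 k : 0 < max_diam n J k.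
Proof.
by have [u uk ->] := max_diam_attained k; apply: diam_gt0; exists k.
Qed.

Lemma max_diam_decr k : max_diam n J k.+1 < max_diam n J k.
Proof.
have [u uk ->] := max_diam_attained k.+1.
case/lastP: u uk => [[]//|u i] uk; have [uk' _] := (words_rcons _ _ _ _).1 uk.
by apply: lt_le_trans (diam_le_max uk'); apply: diam_rcons_lt; exists k.+1.
Qed.

Lemma small_diam_long K : exists2 delta, 0 < delta &
  forall u, finite_words n u -> D u <= delta -> (K <= size u)%N.
Proof.
pose low k := D [::] * \prod_(i < k) min_ratio n c i.
have low0 k : 0 < low k.
  by rewrite mulr_gt0 ?moran_diam0_gt0// prodr_gt0// => i _; exact: min_ratio_gt0.
have lowS k : low k.+1 = low k * min_ratio n c k by rewrite /low big_ord_recr mulrA.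
have low_anti k m : (k <= m)%N -> low m <= low k.
  elim: m => [|m IH]; first by rewrite leqn0 => /eqP ->.
  rewrite leq_eqVlt => /predU1P[->//|/IH/(le_trans _)]; apply.
  rewrite lowS ger_pMr// (le_trans (min_ratio_le (n_gt0 m)))// ltW//.
  exact: moran_ratio_lt1.
have lowD u : finite_words n u -> low (size u) <= D u.
  elim/last_ind: u => [_|u i IH uw]; first by rewrite /low big_ord0 mulr1.
  have [un iu] := finite_words_rcons uw.
  rewrite size_rcons lowS diam_rcons// ler_pM ?min_ratio_le ?(ltW (low0 _))//.
    exact/ltW/min_ratio_gt0.
  by apply: IH; exists (size u).
exists (low K / 2) => [|u uw Du]; first by rewrite divr_gt0.
rewrite leqNgt; apply/negP => uK.
have := le_trans (low_anti _ _ (ltnW uK)) (le_trans (lowD u uw) Du).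
by have := low0 K; lra.
Qed.

Hypothesis ratio_lim :
  (fun k : nat => ln (min_ratio n c k) / ln (max_diam n J k.+1)) @ \oo --> (0 : R).

(** The logarithms of the smallest ratios stay below a negative constant, so
    their quotients by [ln (max_diam n J k.+1)] tend to 0 only if the latter is
    unbounded; being decreasing, it tends to [-oo]. Where this logarithm is 0
    the quotient says nothing, but a strictly decreasing sequence vanishes only
    once. *)
Lemma ln_max_diam_tends (A : R) :
  exists K, forall k, (K <= k)%N -> ln (max_diam n J k.+1) < - A.
Proof.
pose L k := ln (max_diam n J k.+1).
have L_decr k : L k.+1 < L k.
  by rewrite ltr_ln ?posrE ?max_diam_gt0// max_diam_decr.
have L_le0 k : L k <= L 0%N by elim: k => // k; apply: le_trans; exact: ltW.
pose b : R := ln 2 / d%:R.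
have b0 : 0 < b by rewrite divr_gt0 ?ln_gt0 ?ltr1n// ltr0n moran_dim_gt0.
pose B := Num.max A (`|L 0%N| + 1).
have B0 : 0 < B by rewrite lt_max ltr_wpDl ?orbT.
have L0B : L 0%N < B.
  by rewrite lt_max; apply/orP; right; have := ler_norm (L 0%N); lra.
have /cvgrPdist_lt/(_ _ (divr_gt0 b0 B0)) [N _ NP] := ratio_lim.
have L_lt k : (N <= k)%N -> L k != 0 -> L k < - B.
  move=> Nk Lk0; have := NP _ Nk; rewrite /= sub0r normrN normrM normfV.
  rewrite ltr_pdivrMr ?normr_gt0// => lt1.
  have m_le := ln_min_ratio_le k; rewrite -/b in m_le.
  have lt2 : b < b / B * `|L k|.
    by apply: le_lt_trans lt1; rewrite ler0_norm; lra.
  have {lt2} : B < `|L k|.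
    by move: lt2; rewrite mulrAC ltr_pdivlMr// ltr_pM2l.
  by have := L_le0 k; case: (lerP 0 (L k)) => [/ger0_norm|/ltr0_norm] ->; lra.
exists N.+1 => -[//|k] Nk; apply: (@lt_le_trans _ _ (- B)).
  apply: (L_lt k.+1); first exact: ltnW.
  apply/negP => /eqP Lk0; have Lk := L_decr k; rewrite Lk0 in Lk.
  by have := L_lt k Nk (lt0r_neq0 Lk); lra.
by rewrite lerN2 le_max lexx.
Qed.

Lemma diam_tends (e : R) : 0 < e ->
  exists K, forall u, finite_words n u -> (K <= size u)%N -> D u < e.
Proof.
move=> e0; have [K KP] := ln_max_diam_tends (- ln e).
exists K.+1 => u uw; case: (size u) (finite_words_size uw) => // k uk Kk.
apply: le_lt_trans (diam_le_max uk) _.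
by rewrite -ltr_ln ?posrE ?max_diam_gt0// -[ln e]opprK KP.
Qed.

Lemma max_diam_powR_le (eta : R) : 0 < eta ->
  exists K, forall k, (K <= k)%N -> max_diam n J k.+1 `^ eta <= min_ratio n c k.
Proof.
move=> eta0; have [K KP] := ln_max_diam_tends 0.
have /cvgrPdist_lt/(_ _ eta0) [N _ NP] := ratio_lim.
exists (maxn K N) => k; rewrite geq_max => /andP[/KP Lk /NP/=].
rewrite oppr0 in Lk; rewrite sub0r normrN normrM normfV.
rewrite ltr_pdivrMr ?normr_gt0 ?lt_eqF// (ltr0_norm Lk) => lt1.
rewrite -ler_ln ?posrE ?powR_gt0 ?max_diam_gt0 ?min_ratio_gt0// ln_powR.
by have := ler_norm (- ln (min_ratio n c k)); rewrite normrN; lra.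
Qed.

(** The set of a word is not much smaller than that of its parent: this and the
    convergence of the diameters to 0 are what the hypothesis on the ratios is
    for. With [eta' = eta / (1 + eta)] it gives
    [D u >= D (parent u) * max_diam ^ eta' >= D (parent u) * D u ^ eta']. *)
Lemma diam_parent_powR_le (eta : R) : 0 < eta -> exists2 delta, 0 < delta &
  forall u, finite_words n u -> u != [::] -> D u <= delta ->
    D (parent u) `^ (1 + eta) <= D u.
Proof.
move=> eta0; pose eta' := eta / (1 + eta).
have eta1 : 0 < 1 + eta by rewrite addr_gt0.
have eta'0 : 0 < eta' by rewrite divr_gt0.
have [K KP] := max_diam_powR_le eta'0.
have [delta delta0 deltaP] := small_diam_long K.+1.
exists delta => // u uw u0 /(deltaP _ uw).
case/lastP: u u0 uw => // u i _ uw; rewrite size_rcons ltnS => /KP Ku.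
have [un iu] := finite_words_rcons uw; rewrite parent_rcons.
have uw' : finite_words n u by exists (size u).
have Dui := diam_gt0 uw; have Du := diam_gt0 uw'.
have le1 : D u * D (rcons u i) `^ eta' <= D (rcons u i).
  rewrite {2}diam_rcons// ler_pM2l//.
  apply: le_trans (min_ratio_le iu); apply: le_trans Ku.
  apply: ge0_ler_powR; rewrite ?nnegrE ?(ltW eta'0) ?(ltW (max_diam_gt0 _)) ?(ltW Dui)//.
  by apply: diam_le_max; rewrite -(size_rcons u i); exact: finite_words_size.
have le2 : D u <= D (rcons u i) `^ (1 - eta').
  rewrite powRB ?powRr1 ?(ltW Dui)//; last by rewrite (gt_eqF Dui) implybT.
  by rewrite ler_pdivlMr ?powR_gt0.
have -> : D (rcons u i) = (D (rcons u i) `^ (1 - eta')) `^ (1 + eta).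
  rewrite -powRrM (_ : (1 - eta') * (1 + eta) = 1) ?powRr1 ?(ltW Dui)//.
  by rewrite /eta'; field; rewrite gt_eqF.
by apply: ge0_ler_powR; rewrite ?nnegrE ?powR_ge0 ?(ltW eta1) ?(ltW Du).
Qed.

End Sizes.

(** * Points and multiplicities *)

Section Geometry.
Variables (R : realType) (d : nat) (n : nat -> nat) (c : nat -> nat -> R).
Variable J : seq nat -> set 'rV[R]_d.
Hypothesis moranJ : moran_structure n c J.

Local Notation D u := (diam (J u)).
Local Notation E := (moran_set n J).
Let n_gt0 := moran_branching_gt0 moranJ.

Lemma finite_words_cat u t : finite_words n (u ++ t) -> finite_words n u.
Proof.
elim/last_ind: t => [|t i IH]; first by rewrite cats0.
rewrite -rcons_cat => /finite_words_rcons[utn _]; apply: IH.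
by exists (size (u ++ t)).
Qed.

Lemma moran_nested_cat u t : finite_words n (u ++ t) -> J (u ++ t) `<=` J u.
Proof.
elim/last_ind: t => [|t i IH]; first by rewrite cats0 => _; exact: subset_refl.
rewrite -rcons_cat => /finite_words_rcons[utn iu].
apply: subset_trans (moran_nested moranJ utn iu) _.
by apply: IH; exists (size (u ++ t)).
Qed.

Lemma first_difference (u v : seq nat) : ~~ prefix u v -> ~~ prefix v u ->
  exists p i j s t, [/\ i <> j, u = rcons p i ++ s & v = rcons p j ++ t].
Proof.
elim: u v => [|i u IH] [|j v]; rewrite ?prefix0s//= !(eq_sym j).
have [->|/eqP ij _ _] := eqVneq i j; last first.
  by exists [::], i, j, u, v.
rewrite ?eqxx/= => uv vu; have [p [k [l [s [t [kl -> ->]]]]]] := IH v uv vu.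
by exists (j :: p), k, l, s, t.
Qed.

(** The two sets lie in the sets of two siblings, where the words first differ. *)
Lemma moran_disjoint_interiors u v : finite_words n u -> finite_words n v ->
  ~~ prefix u v -> ~~ prefix v u -> (J u)° `&` (J v)° = set0.
Proof.
move=> uw vw uv vu; have [p [i [j [s [t [ij uE vE]]]]]] := first_difference uv vu.
rewrite uE vE in uw vw *.
have [pn ip] := finite_words_rcons (finite_words_cat uw).
have [_ jp] := finite_words_rcons (finite_words_cat vw).
rewrite -subset0 -(moran_disjoint moranJ pn ip jp ij).
by apply: setISS; apply: interiorS; exact: moran_nested_cat.
Qed.

Lemma moran_nonempty u : finite_words n u -> J u !=set0.
Proof.
move=> /(moran_similar moranJ)[Psi _ ->].
have [x /interior_subset Jx] := moran_interior moranJ.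
by exists (Psi x), x.
Qed.

(** The sets along an infinite word are compact, nonempty and nested. *)
Lemma moran_point w : infinite_words n w ->
  exists x, E x /\ forall k, J (mkseq w k) x.
Proof.
move=> wn; have kw k : finite_words n (mkseq w k).
  by exists k => //; exact: words_mkseq.
have /choice[x xP] k := moran_nonempty (kw k).
have Jx m k : (k <= m)%N -> J (mkseq w k) (x m).
  move=> km; have mE : mkseq w k ++ drop k (mkseq w m) = mkseq w m.
    by rewrite -(mkseq_take w km) cat_take_drop.
  by have := @moran_nested_cat (mkseq w k) (drop k (mkseq w m)); rewrite mE;
    apply; [exact: kw | exact: xP].
have [|y [_ yx]] := moran_compact moranJ (F := x @ \oo).
- by exists 0%N => // m _ /=; exact: (Jx m 0%N).
have Jy k : J (mkseq w k) y.
  have [closedJ _] := moran_closed moranJ (kw k); apply: closedJ.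
  by move=> B /yx; apply; exists k => // m /= km; exact: Jx.
exists y; split=> // k _; exists (mkseq w k) => //; exact: words_mkseq.
Qed.

(** Similar sets contain cubes of proportional sizes, with the same constant. *)
Lemma moran_inner_cube : exists2 a : R, 0 < a & forall u, finite_words n u ->
  exists x : 'rV[R]_d, forall y : 'rV[R]_d,
      (forall i, `|x ord0 i - y ord0 i| <= a * D u) -> (J u)° y.
Proof.
have [x /nbhs_ballP[e /= e0 xe]] := moran_interior moranJ.
have D0 := moran_diam0_gt0 moranJ.
have {}xe (y : 'rV[R]_d) : (forall i, `|x ord0 i - y ord0 i| < e) -> J [::] y.
  move=> xy; apply: xe; split=> // i j; rewrite (ord1 i) -ball_normE; exact: xy.
exists (e / (d.+1%:R *+ 2) / D [::]).
  by rewrite !divr_gt0// pmulrn_lgt0.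
move=> u uw; have [Psi [r r0 Psir] JE] := moran_similar moranJ uw.
have Dr : D u <= r * D [::].
  rewrite -lee_fin -ediam_diam ?(diam_gt0 moranJ)//.
  apply: ediam_le; first by rewrite mulr_ge0// ltW.
  rewrite JE => _ _ [y Jy <-] [z Jz <-]; rewrite Psir ler_wpM2l ?(ltW r0)//.
  exact: diam_ub.
exists (Psi x) => y xy; rewrite JE.
apply: (interior_similarity r0 Psir xe e0) => i; apply: le_trans (xy i) _.
rewrite -[leRHS]mulrA [leRHS]mulrC -[leLHS]mulrA ler_wpM2l//.
  by rewrite divr_ge0 ?mulrn_wge0 ?(ltW e0).
by rewrite mulrC ler_pdivrMr.
Qed.

(** A set of diameter at most [r] meets few of the words of size about [r]:
    these have disjoint interiors and contain cubes of half-side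
    [a * r ^ (1 + eta)], inside a cube of half-side [2 * r]. *)
Lemma card_words_meeting : exists2 C : R, 0 < C &
  forall (eta r : R) (A : set 'rV[R]_d) (s : seq (seq nat)),
    0 < eta -> 0 < r <= 1 -> (ediam A <= r%:E)%E -> uniq s ->
    (forall u v, u \in s -> v \in s -> prefix u v -> u = v) ->
    (forall u, u \in s ->
      [/\ finite_words n u, r `^ (1 + eta) <= D u, D u <= r & J u `&` A !=set0]) ->
    (size s)%:R <= C * r `^ (- (d%:R * eta)).
Proof.
have [a a0 aP] := moran_inner_cube.
have /choice[x xP] u : exists x : 'rV[R]_d, finite_words n u ->
    forall y : 'rV[R]_d,
      (forall i, `|x ord0 i - y ord0 i| <= a * D u) -> (J u)° y.
  by have [/aP[x]|?] := pselect (finite_words n u); [exists x | exists 0].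
have C0 : 0 < 4 / a + 1 by rewrite addr_gt0// divr_gt0.
exists ((4 / a + 1) ^+ d); first by rewrite exprn_gt0.
move=> eta r A s eta0 /andP[r0 r1] Ar us incomp sP.
have [->|/eqP s0] := eqVneq s [::].
  by rewrite mulr_ge0 ?powR_ge0// exprn_ge0// ltW.
have [p Ap] : A !=set0.
  case: s s0 sP {us incomp} => // u s _ /(_ u (mem_head _ _))[_ _ _ [p []]].
  by exists p.
pose h := a * r `^ (1 + eta).
have h0 : 0 < h by rewrite mulr_gt0// powR_gt0.
apply: (@le_trans _ _ (((r *+ 2) *+ 2 / h + 1) ^+ d)).
  apply: (@card_disjoint_le _ _ _ s (fun u => (J u)°) x p) => //.
  - by rewrite mulrn_wge0// ltW.
  - move=> u v us' vs' uv; have [uw _ _ _] := sP _ us'; have [vw _ _ _] := sP _ vs'.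
    apply: moran_disjoint_interiors => //; apply: contraNN uv => pre; apply/eqP.
      exact: incomp.
    exact/esym/incomp.
  - move=> u y us' xy; have [uw ru _ _] := sP _ us'; apply: xP => // i.
    by rewrite (le_trans (xy i))// ler_pM2l.
  - move=> u y us' /interior_subset Juy i.
    have [uw _ ur [q [Juq Aq]]] := sP _ us'.
    rewrite (_ : _ - _ = (y ord0 i - q ord0 i) + (q ord0 i - p ord0 i)); last by ring.
    rewrite mulr2n (le_trans (ler_normD _ _))// lerD//.
      apply: le_trans (coord_le_eucl_dist _ _ _) _; apply: le_trans ur.
      by apply: diam_ub => //; exact: (diam_gt0 moranJ).
    apply: le_trans (coord_le_eucl_dist _ _ _) _.
    by rewrite -lee_fin; apply: le_trans Ar; exact: ediam_ub.
have eta_ge0 := ltW eta0; have r_ge0 := ltW r0.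
have -> : r `^ (- (d%:R * eta)) = (r `^ (- eta)) ^+ d.
  by rewrite -powR_mulrn ?powR_ge0// -powRrM mulNr mulrC.
have rN1 : 1 <= r `^ (- eta).
  by rewrite -(powRr0 r) ger_powR ?r0// oppr_le0.
rewrite -exprMn; apply: lerXn2r.
- by rewrite nnegrE addr_ge0 ?divr_ge0 ?mulrn_wge0 ?(ltW h0).
- by rewrite nnegrE mulr_ge0 ?powR_ge0// ltW.
have -> : (r *+ 2) *+ 2 / h = 4 / a * r `^ (- eta).
  rewrite /h powRN powRD ?powRr1//; last by rewrite (gt_eqF r0) implybT.
  by field; rewrite !gt_eqF// powR_gt0.
by rewrite [leRHS]mulrDl mul1r lerD2l.
Qed.

End Geometry.

(** * Covers and cut sets *)

Section Covers.
Variables (R : realType) (d : nat) (n : nat -> nat) (c : nat -> nat -> R).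
Variable J : seq nat -> set 'rV[R]_d.
Hypothesis moranJ : moran_structure n c J.

Local Notation D u := (diam (J u)).
Local Notation E := (moran_set n J).
Let n_gt0 := moran_branching_gt0 moranJ.

Lemma moran_sub_cut M : cut_set n M -> E `<=` \bigcup_(u in M) J u.
Proof.
move=> cutM x Ex; have [K MK] := cut_set_bounded n_gt0 cutM.
have [//|v vK Jvx] := Ex K.+1.
have vw : finite_words n v by exists K.+1.
have [u [[Mu uE] _]] := (proj2 cutM) _ (infinite_nth n_gt0 vw).
exists u => //; have uv : (size u <= size v)%N.
  by rewrite (proj1 vK) ltnW// ltnS MK.
have vE : v = u ++ drop (size u) v.
  by rewrite {1}uE -(mkseq_take _ uv) mkseq_nth cat_take_drop.
by move: Jvx vw; rewrite vE => Jx /(moran_nested_cat moranJ); apply.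
Qed.

(** Sets [J u] that are too small are enlarged to the least admissible diameter
    [tau]; since [tau ^ (1 + eta) <= D u], this multiplies exponents by at most
    [1 + eta]. *)
Lemma cut_theta_cover (theta delta s s' eta B : R) (ms : seq (seq nat)) :
  cut_set n [set` ms] -> 0 < delta <= 1 ->
  0 <= theta_scale theta delta <= delta -> 0 <= s' -> (1 + eta) * s' <= s ->
  0 < eta ->
  (forall u, u \in ms ->
    D u <= delta /\ theta_scale theta delta `^ (1 + eta) <= D u) ->
  \sum_(u <- ms) D u `^ s' <= B ->
  theta_cover theta s (B * delta `^ (s - (1 + eta) * s')) delta E.
Proof.
set tau := theta_scale theta delta.
move=> cutM /andP[delta0 delta1] /andP[tau0 tau_le] s'0 ss' eta0 msP sumB.
have msw u : u \in ms -> finite_words n u by exact: (proj1 cutM).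
have /choice[V VP] u : exists V, u \in ms ->
    J u `<=` V /\ ediam V = (Num.max (D u) tau)%:E.
  have [ums|?] := boolP (u \in ms); last by exists set0.
  have Du := diam_gt0 moranJ (msw _ ums).
  have [tauD|Dtau] := leP tau (D u).
    by exists (J u) => _; split=> //; rewrite ediam_diam.
  have [||U JU UE] := @ediam_enlarge _ _ (J u) tau (moran_dim_gt0 moranJ).
  - exact: (moran_nonempty moranJ (msw _ ums)).
  - by rewrite ediam_diam// lee_fin ltW.
  by exists U.
pose a i := nth [::] ms i.
have ams i : (i < size ms)%N -> a i \in ms by move=> ?; exact: mem_nth.
exists `I_(size ms), (fun i => V (a i)); split.
- move=> x /(moran_sub_cut cutM)[u /= ums Jux]; exists (index u ms).
    by rewrite /= index_mem.
  by rewrite /a nth_index//; apply: (proj1 (VP _ ums)).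
- move=> i /ams ai; rewrite (proj2 (VP _ ai)) !lee_fin le_max lexx orbT ge_max.
  by rewrite tau_le (proj1 (msP _ ai)).
rewrite esum_fset//; last by move=> i _; exact: poweR_ge0.
have bnd u : u \in ms ->
    Num.max (D u) tau `^ s <= D u `^ s' * delta `^ (s - (1 + eta) * s').
  move=> ums; have Du := diam_gt0 moranJ (msw _ ums).
  have [Dd tauD] := msP _ ums; set m := Num.max _ _.
  have m0 : 0 < m by rewrite lt_max Du.
  have mD : m `^ (1 + eta) <= D u.
    rewrite /m; case: (leP (D u) tau) => // _.
    rewrite -[leRHS]powRr1 ?(ltW Du)// ger_powR ?lerDl ?(ltW eta0)//.
    by rewrite Du (le_trans Dd).
  rewrite -[s in leLHS](subrKC ((1 + eta) * s')) [leLHS]powRD; last first.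
    by rewrite (gt_eqF m0) implybT.
  apply: ler_pM; rewrite ?powR_ge0//.
    by rewrite powRrM ge0_ler_powR ?nnegrE ?powR_ge0 ?(ltW Du).
  rewrite ge0_ler_powR ?nnegrE ?(ltW delta0) ?(ltW m0) ?subr_ge0//.
  by rewrite ge_max Dd.
apply: (@le_trans _ _ (\sum_(u <- ms) (Num.max (D u) tau `^ s)%:E)%E).
  rewrite (big_nth [::]) -fsbig_ord// big_mkord.
  by apply: lee_sum => i _; rewrite (proj2 (VP _ (ams _ _)))// poweR_EFin.
rewrite sumEFin lee_fin.
apply: (@le_trans _ _ ((\sum_(u <- ms) D u `^ s') * delta `^ (s - (1 + eta) * s'))).
  by rewrite mulr_suml big_seq [leRHS]big_seq ler_sum.
by rewrite ler_wpM2r ?powR_ge0.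
Qed.

Hypothesis ratio_lim :
  (fun k : nat => ln (min_ratio n c k) / ln (max_diam n J k.+1)) @ \oo --> (0 : R).

(** Along an infinite word the diameters decrease to 0. *)
Lemma first_passage (r : R) w : 0 < r < D [::] -> infinite_words n w ->
  exists k, D (mkseq w k.+1) <= r < D (mkseq w k).
Proof.
move=> /andP[r0 rD] wn; have [K KP] := diam_tends moranJ ratio_lim r0.
have ex : exists k, D (mkseq w k) <= r.
  exists K; rewrite ltW// KP// ?size_mkseq//; exists K => //; exact: words_mkseq.
case: (ex_minnP ex) => -[|k] Dk kmin; first by have := lt_le_trans rD Dk; rewrite ltxx.
exists k; rewrite Dk ltNge; apply/negP => /kmin.
by rewrite ltnn.
Qed.

(** Conversely, replace each set [U i] of a cover by the sets [J u] of comparable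
    size that meet it. Every infinite word has such a prefix, because it
    determines a point of [E]; hence some of these words form a cut set. For
    each [i] there are at most [C * r i ^ (- d eta)] of them, which accounts for
    the loss in the exponent. *)
Lemma cover_to_cut (eta s : R) : 0 < eta -> 0 <= s ->
  exists C delta0 : R, [/\ 0 < C, 0 < delta0 &
  forall (I0 : set nat) (U : nat -> set 'rV[R]_d) (r : nat -> R),
    E `<=` \bigcup_(i in I0) U i ->
    (forall i, I0 i -> 0 < r i <= delta0 /\ (ediam (U i) <= (r i)%:E)%E) ->
  exists ms : seq (seq nat), [/\ uniq ms, cut_set n [set` ms],
    forall u, u \in ms -> exists2 i, I0 i & D u <= r i < D (parent u) &
    exists F : seq nat, [/\ uniq F, forall i, i \in F -> I0 i &
      \sum_(u <- ms) D u `^ s <= C * \sum_(i <- F) r i `^ (s - d%:R * eta)]]].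
Proof.
move=> eta0 s0; have [C C0 CP] := card_words_meeting moranJ.
have [delta1 delta10 reg] := diam_parent_powR_le moranJ ratio_lim eta0.
have D0 := moran_diam0_gt0 moranJ.
pose delta0 := Num.min (Num.min 1 delta1) (D [::] / 2).
have delta00 : 0 < delta0 by rewrite !lt_min delta10 ltr01 divr_gt0.
exists C, delta0; split=> // I0 U r EU rP.
pose near u i := [/\ I0 i, D u <= r i < D (parent u) & J u `&` U i !=set0].
pose W := [set u | finite_words n u /\ exists i, near u i].
have barW w : infinite_words n w -> exists k, W (mkseq w k).
  move=> wn; have [x [Ex Jx]] := moran_point moranJ wn.
  have [i Ii Uix] := EU x Ex; have [/andP[ri0 rid] _] := rP i Ii.
  have [|k Dk] := @first_passage (r i) w _ wn.
    by move: rid; rewrite ri0 !le_min => /andP[_]; lra.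
  exists k.+1; split; first by exists k.+1 => //; exact: words_mkseq.
  by exists i; split=> //; [rewrite mkseqS parent_rcons -mkseqS | exists x].
have [|M cutM MW] := bar_cut_set _ barW; first by move=> u [].
have [ms ums ME] := cut_set_seq n_gt0 cutM; rewrite {}ME in cutM MW.
have /choice[f fP] u : exists i, u \in ms -> near u i.
  by have [/MW[_ [i ?]]|?] := boolP (u \in ms); [exists i | exists 0%N].
exists ms; split=> //; first by move=> u /fP[]; exists (f u).
exists (undup (map f ms)); split; first exact: undup_uniq.
  by move=> i; rewrite mem_undup => /mapP[u /fP[? _ _] ->].
rewrite (sum_partition_seq _ f) mulr_sumr big_seq [leRHS]big_seq.
apply: ler_sum => i; rewrite mem_undup => /mapP[v /fP[Ii _ _] iE].
rewrite -{}iE in Ii; have [/andP[ri0 rid] Ui] := rP i Ii.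
move: rid; rewrite !le_min -andbA => /and3P[ri1 rid1 riD].
set t := [seq u <- ms | f u == i].
have tP u : u \in t -> [/\ u \in ms, finite_words n u & near u i].
  rewrite mem_filter => /andP[/eqP <- us]; split=> //; last exact: fP.
  by have [] := MW _ us.
rewrite -big_filter -/t.
apply: (@le_trans _ _ (\sum_(u <- t) r i `^ s)).
  rewrite big_seq [leRHS]big_seq; apply: ler_sum => u /tP[_ uw [_ /andP[Du _] _]].
  by rewrite ge0_ler_powR ?nnegrE ?(ltW ri0) ?diam_ge0.
rewrite big_const_seq count_predT iter_addr addr0 -[leLHS]mulr_natl.
have -> : r i `^ (s - d%:R * eta) = r i `^ (- (d%:R * eta)) * r i `^ s.
  by rewrite -powRD 1?addrC// (gt_eqF ri0) implybT.
rewrite mulrA ler_wpM2r ?powR_ge0//.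
apply: (CP _ _ (U i)) => //; first by rewrite ri0.
- exact: filter_uniq.
- move=> u w /tP[us _ _] /tP[ws _ _]; exact: (cut_set_prefix n_gt0 cutM).
move=> u /tP[us uw [_ /andP[Du rD] JU]]; split=> //.
have u0 : u != [::].
  by apply/eqP => u0; have := le_lt_trans Du rD; rewrite u0 /parent/= ltxx.
apply: le_trans (reg u uw u0 (le_trans Du rid1)).
by rewrite ge0_ler_powR ?nnegrE ?diam_ge0 ?(ltW ri0) ?(ltW rD)// addr_ge0// ltW.
Qed.

End Covers.

(** * Exponents of cut sets *)

Section Exponents.
Variables (R : realType) (d : nat) (n : nat -> nat) (c : nat -> nat -> R).
Variable J : seq nat -> set 'rV[R]_d.
Hypothesis moranJ : moran_structure n c J.
Hypothesis ratio_lim :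
  (fun k : nat => ln (min_ratio n c k) / ln (max_diam n J k.+1)) @ \oo --> (0 : R).

Local Notation D u := (diam (J u)).
Local Notation E := (moran_set n J).
Let n_gt0 := moran_branching_gt0 moranJ.
Let D0 := moran_diam0_gt0 moranJ.

Lemma cut_seq_nonempty (ms : seq (seq nat)) : cut_set n [set` ms] -> ms != [::].
Proof.
by move=> /(cut_set_nonempty n_gt0)[u]; case: ms.
Qed.

Definition admissible (theta delta : R) (ms : seq (seq nat)) :=
  [/\ uniq ms, cut_set n [set` ms] & forall u, u \in ms ->
    delta `^ theta^-1 < D (parent u) /\ D u <= delta].

Lemma admissible_diam theta delta ms : delta < 1 -> admissible theta delta ms ->
  forall u, u \in ms -> 0 < D u < 1.
Proof.
move=> delta1 [_ [msw _] msP] u ums.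
rewrite (diam_gt0 moranJ (msw _ ums)).
by rewrite (le_lt_trans (proj2 (msP _ ums))).
Qed.

Lemma cut_exponentsP theta delta s : cut_exponents n J theta delta s <->
  exists2 ms, admissible theta delta ms & \sum_(u <- ms) D u `^ s = 1.
Proof.
split=> [[M [cutM MP sum1]]|[ms [ums cutms msP] sum1]]; last first.
  by exists [set` ms]; split=> //; rewrite -fsbig_seq.
have [ms ums ME] := cut_set_seq n_gt0 cutM; rewrite {}ME in cutM MP sum1.
by exists ms; [split | rewrite fsbig_seq].
Qed.

Lemma admissible_exists theta delta : 0 < theta <= 1 -> 0 < delta < 1 ->
  delta < D [::] -> exists ms, admissible theta delta ms.
Proof.
move=> /andP[theta0 theta1] /andP[delta0 delta1] deltaD.
pose W := [set u | finite_words n u /\ D u <= delta < D (parent u)].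
have [u []//|w wn|M cutM MW] := @bar_cut_set n W.
  have [|k Dk] := @first_passage _ _ _ _ _ moranJ ratio_lim delta w _ wn.
    by rewrite delta0.
  exists k.+1; split; first by exists k.+1 => //; exact: words_mkseq.
  by rewrite mkseqS parent_rcons -mkseqS.
have [ms ums ME] := cut_set_seq n_gt0 cutM; rewrite {}ME in cutM MW.
exists ms; split=> // u /MW[_ /andP[Du uD]]; split=> //; apply: le_lt_trans uD.
by rewrite ge1r_powR ?delta0 ?(ltW delta1)// invf_ge1.
Qed.

(** The parents of admissible words are not small, hence the words have bounded
    length and there are finitely many admissible cut sets, thus finitely many
    exponents. *)
Lemma cut_exponents_finite theta delta : 0 < delta < 1 ->
  finite_set (cut_exponents n J theta delta).
Proof.
move=> /andP[delta0 delta1].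
have [K KP] := diam_tends moranJ ratio_lim (powR_gt0 theta^-1 delta0).
have [s us sE] : exists2 s : seq (seq nat), uniq s &
    [set u | finite_words n u /\ (size u <= K)%N] = [set` s].
  by apply: (@bounded_words_seq n _ K) => u [].
pose g (m : (size s).-tuple bool) :=
  get [set t : R | \sum_(u <- mask m s) D u `^ t = 1].
apply: (@sub_finite_set _ _ (g @` [set: (size s).-tuple bool])); last first.
  exact/finite_image/finite_finset.
move=> t /cut_exponentsP[ms adm sum1].
exists (map_tuple (fun u => u \in ms) (in_tuple s)) => //.
have msE : perm_eq ms (mask (map (fun u => u \in ms) s) s).
  rewrite -filter_mask; apply: uniq_perm; rewrite ?filter_uniq//.
    by case: adm.
  move=> u; rewrite mem_filter; apply/idP/andP => [ums|[]//]; split=> //.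
  have [_ [msw _] msP] := adm.
  have : [set` s] u; last by [].
  rewrite -sE; split; first exact: msw.
  rewrite leqNgt; apply/negP => Ku; have [+ _] := msP _ ums; apply/negP.
  rewrite -leNgt ltW//.
  case/lastP: u ums Ku => [//|u i] ums; rewrite size_rcons ltnS => Ku.
  have [un _] := finite_words_rcons (msw _ ums).
  by rewrite parent_rcons; apply: KP => //; exists (size u).
have sumE x : \sum_(u <- mask (map (fun u => u \in ms) s) s) D u `^ x =
    \sum_(u <- ms) D u `^ x by rewrite (perm_big _ msE).
rewrite /g/=; apply: xget_unique => /= [|x]; rewrite ?sumE// => sumx.
have ms0 : ms != [::] by apply: cut_seq_nonempty; case: adm.
have ms01 := admissible_diam delta1 adm.
have [/(exp_sum_anti ms01 ms0)|/(exp_sum_anti ms01 ms0)|//] := ltgtP x t;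
  by rewrite sum1 sumx ltxx.
Qed.

Lemma s_delta_min theta delta : 0 < theta <= 1 -> 0 < delta < 1 ->
  delta < D [::] ->
  cut_exponents n J theta delta (s_delta n J theta delta) /\
  lbound (cut_exponents n J theta delta) (s_delta n J theta delta).
Proof.
move=> theta01 delta01 deltaD; rewrite /s_delta.
apply: (@getPex _ [set s | cut_exponents n J theta delta s /\
  lbound (cut_exponents n J theta delta) s]).
have [_ delta1] := andP delta01.
have /finite_seqP[s sE] := cut_exponents_finite theta delta01.
have [ms adm] := admissible_exists theta01 delta01 deltaD.
have ms0 : ms != [::] by apply: cut_seq_nonempty; case: adm.
have [t sum1] := exp_sum_root (admissible_diam delta1 adm) ms0.
have : cut_exponents n J theta delta t by apply/cut_exponentsP; exists ms.
rewrite sE /= => ts; have s0 : s != [::] by case: (s) ts.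
have [x xs xmax] := seq_argmax -%R s0; exists x; split=> //= y ys.
by rewrite -lerN2; exact: xmax.
Qed.

Lemma s_delta_ge0 theta delta : 0 < theta <= 1 -> 0 < delta < 1 ->
  delta < D [::] -> 0 <= s_delta n J theta delta.
Proof.
move=> theta01 delta01 deltaD; have [_ delta1] := andP delta01.
have [/cut_exponentsP[ms adm sum1] _] := s_delta_min theta01 delta01 deltaD.
apply: exp_sum_ge0 sum1; first exact: admissible_diam adm.
by apply: cut_seq_nonempty; case: adm.
Qed.

Lemma s_delta_lt theta delta s : 0 < theta <= 1 -> 0 < delta < 1 ->
  delta < D [::] -> s_delta n J theta delta < s ->
  exists2 ms, admissible theta delta ms & \sum_(u <- ms) D u `^ s <= 1.
Proof.
move=> theta01 delta01 deltaD lts; have [_ delta1] := andP delta01.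
have [/cut_exponentsP[ms adm sum1] _] := s_delta_min theta01 delta01 deltaD.
exists ms => //; rewrite -sum1 ltW//; apply: exp_sum_anti lts.
  exact: admissible_diam adm.
by apply: cut_seq_nonempty; case: adm.
Qed.

Lemma lt_s_delta theta delta s ms : 0 < theta <= 1 -> 0 < delta < 1 ->
  delta < D [::] -> s < s_delta n J theta delta -> admissible theta delta ms ->
  1 < \sum_(u <- ms) D u `^ s.
Proof.
move=> theta01 delta01 deltaD lts adm; have [_ delta1] := andP delta01.
have [_ lb] := s_delta_min theta01 delta01 deltaD.
have ms0 : ms != [::] by apply: cut_seq_nonempty; case: adm.
have ms01 := admissible_diam delta1 adm.
have [t sum1] := exp_sum_root ms01 ms0.
rewrite -sum1; apply: exp_sum_anti => //; apply: lt_le_trans lts (lb _ _).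
by apply/cut_exponentsP; exists ms.
Qed.

Lemma sum_level_word_ratio s m : \sum_(u <- level n m) word_ratio c u `^ s =
  \prod_(i < m) \sum_(j < n i) c i j `^ s.
Proof.
elim: m => [|m IH] /=.
  by rewrite big_seq1 /word_ratio !big_ord0 powR1.
rewrite big_allpairs_dep big_ord_recr/= -IH mulr_suml.
apply: eq_big_seq => u um; have /mem_level uw := um.
rewrite -(big_mkord xpredT (fun j => c m j `^ s)) /index_iota subn0 mulr_sumr.
apply: eq_big_seq => i; rewrite mem_iota => /= im.
rewrite word_ratio_rcons (size_level um) powRM ?(ltW (moran_ratio_gt0 moranJ im))//.
by rewrite ltW// (word_ratio_gt0 moranJ)//; exists m.
Qed.

Lemma level_ratio01 m u : (0 < m)%N -> u \in level n m -> 0 < word_ratio c u < 1.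
Proof.
move=> m0 /mem_level um; have uw : finite_words n u by exists m.
rewrite (word_ratio_gt0 moranJ uw) (word_ratio_lt1 moranJ uw)//.
by apply/eqP => u0; move: um m0; rewrite u0 => -[<-].
Qed.

Lemma level_nonempty m : level n m != [::].
Proof.
apply/eqP => lev0; have := (mem_level n m _).2 (words_mkseq m n_gt0).
by rewrite lev0.
Qed.

Lemma s_level_root m : (0 < m)%N ->
  \sum_(u <- level n m) word_ratio c u `^ s_level n c m = 1.
Proof.
move=> m0; rewrite sum_level_word_ratio.
apply: (@getPex _ [set s | \prod_(i < m) (\sum_(j < n i) c i j `^ s) = 1]).
have [s sum1] := exp_sum_root (fun u => @level_ratio01 m u m0) (level_nonempty m).
by exists s; rewrite /= -sum_level_word_ratio.
Qed.

Lemma s_level_ge0 m : (0 < m)%N -> 0 <= s_level n c m.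
Proof.
move=> m0; apply: exp_sum_ge0 (s_level_root m0).
  by move=> u; exact: level_ratio01.
exact: level_nonempty.
Qed.

Lemma s_level_lt m s : (0 < m)%N -> s_level n c m < s ->
  \sum_(u <- level n m) word_ratio c u `^ s <= 1.
Proof.
move=> m0 lts; rewrite -(s_level_root m0) ltW//.
by apply: exp_sum_anti lts; [move=> u; exact: level_ratio01 | exact: level_nonempty].
Qed.

Lemma lt_s_level m s : (0 < m)%N -> s < s_level n c m ->
  1 <= \prod_(i < m) \sum_(j < n i) c i j `^ s.
Proof.
move=> m0 lts; rewrite -sum_level_word_ratio -(s_level_root m0) ltW//.
by apply: exp_sum_anti lts; [move=> u; exact: level_ratio01 | exact: level_nonempty].
Qed.

(** Divide the mass of each word [u] between its children in proportion to the
    powers [c (size u) i ^ s] of their ratios. The mass of [u] is then the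
    quotient of [word_ratio c u ^ s] by the product in the hypothesis, with
    [m = size u], hence at most [word_ratio c u ^ s] when [size u >= m0]; and
    the masses of a cut set add up to 1. *)
Lemma cut_sum_ge s (ms : seq (seq nat)) m0 : uniq ms -> cut_set n [set` ms] ->
  (forall m, (m0 <= m)%N -> 1 <= \prod_(i < m) \sum_(j < n i) c i j `^ s) ->
  (forall u, u \in ms -> (m0 <= size u)%N) ->
  D [::] `^ s <= \sum_(u <- ms) D u `^ s.
Proof.
move=> ums cutms prod1 msm0.
pose P m := \prod_(i < m) \sum_(j < n i) c i j `^ s.
pose mu u := word_ratio c u `^ s / P (size u).
have S0 k : 0 < \sum_(j < n k) c k j `^ s.
  rewrite (bigD1 (Ordinal (n_gt0 k)))//= ltr_pwDl ?powR_gt0 ?(moran_ratio_gt0 moranJ)//.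
  by rewrite sumr_ge0// => j _; exact: powR_ge0.
have P0 m : 0 < P m by apply: prodr_gt0 => i _; exact: S0.
have mu_additive k u : words n k u -> \sum_(i < n k) mu (rcons u i) = mu u.
  move=> uk; have uw : finite_words n u by exists k.
  rewrite /mu; transitivity (\sum_(i < n k) (mu u / (\sum_(j < n k) c k j `^ s)) * c k i `^ s).
    apply: eq_bigr => i _; rewrite word_ratio_rcons size_rcons (proj1 uk).
    rewrite powRM ?(ltW (word_ratio_gt0 moranJ uw)) ?(ltW (moran_ratio_gt0 moranJ _))//.
    rewrite /mu (proj1 uk) /P big_ord_recr/= -/(P k).
    by have := P0 k; have := S0 k; move=> /gt_eqF s0 /gt_eqF p0; field; rewrite s0 p0.
  by rewrite -mulr_sumr divfK ?gt_eqF.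
have := cut_set_mass n_gt0 mu_additive ums cutms.
rewrite {2}/mu /P /word_ratio !big_ord0 powR1 divr1 => mass1.
rewrite -[leLHS]mulr1 -mass1 mulr_sumr big_seq [leRHS]big_seq.
apply: ler_sum => u us; have uw : finite_words n u by exact: (proj1 cutms).
rewrite (diam_word moranJ uw) powRM ?(ltW D0) ?(ltW (word_ratio_gt0 moranJ uw))//.
rewrite ler_wpM2l ?powR_ge0// /mu ler_pdivrMr// ler_peMr ?powR_ge0//.
exact/prod1/msm0.
Qed.

End Exponents.

(** * Lower and upper limits *)

Section Limits.
Variables (R : realType) (T : choiceType) (X : filteredType T) (F : set_system X) (f : X -> R).

Lemma limf_esup_lt (x : R) : (limf_esup (fun t => (f t)%:E) F < x%:E)%E ->
  exists2 V, F V & forall t, V t -> f t < x.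
Proof.
rewrite limf_esupE => /ereal_inf_lt[_ [V FV <-] Vx]; exists V => // t Vt.
by rewrite -lte_fin (le_lt_trans _ Vx)//; apply: ereal_sup_ubound; exists t.
Qed.

Lemma lt_limf_esup (x : R) : (x%:E < limf_esup (fun t => (f t)%:E) F)%E ->
  forall V, F V -> exists2 t, V t & x < f t.
Proof.
rewrite limf_esupE => xL V FV; apply: contrapT => Nx; move: xL; apply/negP.
rewrite -leNgt; apply: (@le_trans _ _ (ereal_sup ((fun t => (f t)%:E) @` V))).
  by apply: ereal_inf_lbound; exists V.
apply: ge_ereal_sup => _ [t Vt <-]; rewrite lee_fin leNgt; apply/negP => xt.
by apply: Nx; exists t.
Qed.

Lemma lt_limf_einf (x : R) : (x%:E < limf_einf (fun t => (f t)%:E) F)%E ->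
  exists2 V, F V & forall t, V t -> x < f t.
Proof.
rewrite limf_einfE => /ereal_sup_gt[_ [V FV <-] Vx]; exists V => // t Vt.
by rewrite -lte_fin (lt_le_trans Vx)//; apply: ereal_inf_lbound; exists t.
Qed.

Lemma limf_einf_lt (x : R) : (limf_einf (fun t => (f t)%:E) F < x%:E)%E ->
  forall V, F V -> exists2 t, V t & f t < x.
Proof.
rewrite limf_einfE => xL V FV; apply: contrapT => Nx; move: xL; apply/negP.
rewrite -leNgt; apply: (@le_trans _ _ (ereal_inf ((fun t => (f t)%:E) @` V))).
  apply: le_ereal_inf_tmp => _ [t Vt <-]; rewrite lee_fin leNgt; apply/negP => xt.
  by apply: Nx; exists t.
by apply: ereal_sup_ubound; exists V.
Qed.

End Limits.

Section Dimension.
Variable R : realType.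

Lemma real_between (x y : \bar R) : (x < y)%E -> exists r : R, (x < r%:E < y)%E.
Proof.
case: x y => [x||] [y||]//= xy.
- move: xy; rewrite lte_fin => xy; exists ((x + y) / 2).
  by rewrite !lte_fin !midf_lt.
- by exists (x + 1); rewrite lte_fin ltrDl ltr01 ltry.
- by exists (y - 1); rewrite lte_fin ltrBlDr ltrDl ltr01 ltNyr.
- by exists 0; rewrite ltNyr ltry.
Qed.

(** Comparisons with [L] are only ever available with a loss in the exponent; the
    number [s'] strictly between [s] and [L] makes room for it. *)
Lemma ereal_inf_eq (S : set R) (L : \bar R) :
  (forall s s' : R, (L < s'%:E)%E -> s' < s -> S s) ->
  (forall s s' : R, S s -> (s'%:E < L)%E -> s < s' -> False) ->
  ereal_inf [set s%:E | s in S] = L.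
Proof.
move=> above below; apply/eqP; rewrite eq_le; apply/andP; split.
  rewrite leNgt; apply/negP => /real_between[s' /andP[Ls' /real_between[s /andP[s's sI]]]].
  have := ereal_inf_lbound (S := [set s%:E | s in S]) (x := s%:E).
  rewrite leNgt sI => /(_ _)/negP; apply => //.
  by exists s => //; apply: above Ls' _; rewrite -lte_fin.
apply: le_ereal_inf_tmp => _ [s Ss <-]; rewrite leNgt; apply/negP.
move=> /real_between[s' /andP[ss' s'L]].
by apply: below Ss s'L _; rewrite -lte_fin.
Qed.

Lemma at_right0_interval (e : R) : 0 < e -> 0^'+ [set t : R | 0 < t <= e].
Proof.
move=> e0; near=> t; rewrite /mkset; apply/andP; split; near: t.
  exact: nbhs_right_gt.
exact: nbhs_right_le.
Unshelve. all: by end_near. Qed.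

Lemma at_right0_sub (V : set R) : 0^'+ V ->
  exists2 e : R, 0 < e & forall t, 0 < t <= e -> V t.
Proof.
move=> /nbhs_ballP[e /= e0 eV]; exists (e / 2); first by rewrite divr_gt0.
move=> t /andP[t0 te]; apply: eV => //; rewrite -ball_normE/= sub0r normrN gtr0_norm//.
by lra.
Qed.

Lemma sum_half_powers (F : seq nat) : uniq F ->
  \sum_(i <- F) (2^-1 : R) ^+ i.+1 <= 1.
Proof.
move=> uF; pose N := (\max_(i <- F) i).+1.
have FN i : i \in F -> (i < N)%N by move=> iF; rewrite ltnS; exact: leq_bigmax_seq.
have -> : \sum_(i <- F) (2^-1 : R) ^+ i.+1 = \sum_(i < N | val i \in F) 2^-1 ^+ i.+1.
  rewrite -(big_mkord (fun i => i \in F) (fun i => (2^-1 : R) ^+ i.+1)) -big_filter.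
  apply/perm_big/uniq_perm; rewrite ?filter_uniq ?iota_uniq//.
  move=> i; rewrite mem_filter mem_index_iota/=.
  by case: (boolP (i \in F)) => // /FN ->.
apply: (@le_trans _ _ (\sum_(i < N) 2^-1 ^+ i.+1)).
  by rewrite big_mkcond ler_sum// => i _; case: ifP => // _; rewrite exprn_ge0.
have -> : \sum_(i < N) (2^-1 : R) ^+ i.+1 = 1 - 2^-1 ^+ N.
  elim: N {FN} => [|N IH]; first by rewrite big_ord0 expr0 subrr.
  by rewrite big_ord_recr/= IH exprS; field.
by rewrite lerBlDr lerDl exprn_ge0.
Qed.

End Dimension.

(** * Covers at all small scales *)

Section MoranCovers.
Variables (R : realType) (d : nat) (n : nat -> nat) (c : nat -> nat -> R).
Variable J : seq nat -> set 'rV[R]_d.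
Hypothesis moranJ : moran_structure n c J.
Hypothesis ratio_lim :
  (fun k : nat => ln (min_ratio n c k) / ln (max_diam n J k.+1)) @ \oo --> (0 : R).

Local Notation D u := (diam (J u)).
Local Notation E := (moran_set n J).
Let D0 := moran_diam0_gt0 moranJ.

Lemma theta_cover_weaken (theta s e e' delta : R) (A : set 'rV[R]_d) : e <= e' ->
  theta_cover theta s e delta A -> theta_cover theta s e' delta A.
Proof.
move=> ee' [I0 [U [AU UP sumU]]]; exists I0, U; split=> //.
by apply: le_trans sumU _; rewrite lee_fin.
Qed.

Lemma theta_cover0_mono (s e delta delta' : R) (A : set 'rV[R]_d) :
  delta <= delta' -> theta_cover 0 s e delta A -> theta_cover 0 s e delta' A.
Proof.
move=> dd' [I0 [U [AU UP sumU]]]; exists I0, U; split=> // i /UP.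
rewrite /theta_scale eqxx => /andP[-> Ud]/=.
by apply: le_trans Ud _; rewrite lee_fin.
Qed.

Lemma theta_scale_ge0 (theta delta : R) : 0 <= theta_scale theta delta.
Proof. by rewrite /theta_scale; case: ifP => // _; exact: powR_ge0. Qed.

(** [eta] is so small that [(1 + eta) * s' < s]; then the sum of the cover
    obtained from the cut set is at most [B] times a positive power of
    [delta]. *)
Lemma cut_to_cover (s' s B e : R) : 0 <= s' < s -> 0 < B -> 0 < e ->
  exists2 Delta, 0 < Delta & forall theta delta ms, 0 < delta <= Delta ->
    theta_scale theta delta <= delta -> cut_set n [set` ms] ->
    (forall u, u \in ms -> D u <= delta /\ theta_scale theta delta < D (parent u)) ->
    \sum_(u <- ms) D u `^ s' <= B -> theta_cover theta s e delta E.
Proof.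
move=> /andP[s'0 s's] B0 e0.
pose eta := (s - s') / (s' + 1) / 2.
have s'1 : 0 < s' + 1 by rewrite ltr_wpDl.
have eta0 : 0 < eta by rewrite !divr_gt0// subr_gt0.
have eta_s' : (1 + eta) * s' < s.
  have : eta * (s' + 1) = (s - s') / 2 by rewrite /eta; field; rewrite gt_eqF.
  by rewrite mulrDl mulrDr; lra.
have zeta0 : 0 < s - (1 + eta) * s' by rewrite subr_gt0.
have [Delta1 Delta10 small] := powR_small zeta0 (divr_gt0 e0 B0).
have [Delta2 Delta20 reg] := diam_parent_powR_le moranJ ratio_lim eta0.
exists (Num.min (Num.min 1 Delta1) (Num.min Delta2 (D [::] / 2))).
  by rewrite !lt_min ltr01 Delta10 Delta20 divr_gt0.
move=> theta delta ms /andP[delta0]; rewrite !le_min.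
move=> /andP[/andP[delta1 dDelta1] /andP[dDelta2 dD0]] tau_le cutms msP sumB.
apply: (@theta_cover_weaken _ _ (B * delta `^ (s - (1 + eta) * s'))).
  by rewrite mulrC -ler_pdivlMr// small// delta0.
apply: (cut_theta_cover moranJ cutms _ _ s'0 (ltW eta_s') eta0 _ sumB).
- by rewrite delta0.
- by rewrite theta_scale_ge0.
move=> u ums; have [Du tauD] := msP u ums; split=> //.
have uw : finite_words n u by exact: (proj1 cutms).
apply: le_trans (reg u uw _ (le_trans Du dDelta2)).
  by rewrite ge0_ler_powR ?nnegrE ?theta_scale_ge0 ?diam_ge0 ?addr_ge0 ?(ltW eta0) ?(ltW tauD).
by apply/eqP => u0; move: Du; rewrite u0; lra.
Qed.

(** Here [eta] is such that [s - d * eta = s0]. A set [U i] of diameter 0 has no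
    size to compare words with; it is given a positive one, at the cost of
    [e / 2 ^ (i + 1)] in the sum. *)
Lemma cover_cut_sum (s0 s : R) : 0 <= s0 < s ->
  exists C Delta : R, [/\ 0 < C, 0 < Delta & forall theta delta e,
    0 < delta <= Delta -> 0 < e -> theta_cover theta s0 e delta E ->
    exists ms, [/\ uniq ms, cut_set n [set` ms],
      forall u, u \in ms -> D u <= delta /\ theta_scale theta delta < D (parent u) &
      \sum_(u <- ms) D u `^ s <= C * e]].
Proof.
move=> /andP[s00 s0s].
have d0 : 0 < d%:R :> R by rewrite ltr0n (moran_dim_gt0 moranJ).
pose eta := (s - s0) / d%:R.
have eta0 : 0 < eta by rewrite divr_gt0// subr_gt0.
have s_eta : s - d%:R * eta = s0 by rewrite /eta mulrC divfK ?gt_eqF// opprB addrC subrK.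
have [C [Delta [C0 Delta0 CP]]] :=
  cover_to_cut moranJ ratio_lim eta0 (le_trans s00 (ltW s0s)).
exists (C * 2), Delta; split; rewrite ?mulr_gt0// => theta delta e.
move=> /andP[delta0 deltaD] e0 [I0 [U [EU UP sumU]]].
have rE i : exists ri : R, I0 i ->
    [/\ 0 < ri <= delta, (ediam (U i) <= ri%:E)%E, theta_scale theta delta <= ri &
        ri `^ s0 <= diam (U i) `^ s0 + e * 2^-1 ^+ i.+1].
  have [/UP/andP[tauU Ud]|?] := pselect (I0 i); last by exists 0.
  have UE := ediam_fin Ud; rewrite UE !lee_fin in tauU Ud *.
  have half0 : 0 < e * 2^-1 ^+ i.+1 by rewrite mulr_gt0// exprn_gt0.
  have [U0|U0] := leP (diam (U i)) 0; last first.
    by exists (diam (U i)) => _; rewrite lee_fin U0 Ud tauU lexx lerDl ltW.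
  have {U0}UE0 : diam (U i) = 0 by apply/eqP; rewrite eq_le U0 diam_ge0.
  rewrite UE0 in tauU *.
  have [->|s0N0] := eqVneq s0 0.
    exists delta => _; rewrite lee_fin delta0 lexx !powRr0 lerDl (ltW half0).
    by rewrite (ltW delta0) (le_trans tauU (ltW delta0)).
  have s0_gt0 : 0 < s0 by rewrite lt0r s0N0.
  have [x x0 xP] := powR_small s0_gt0 half0.
  have m0 : 0 < Num.min delta x by rewrite lt_min delta0.
  exists (Num.min delta x) => _.
  rewrite lee_fin m0 ge_min lexx (ltW m0) (le_trans tauU (ltW m0)) powR0// add0r xP//.
  by rewrite m0 ge_min lexx orbT.
have {rE}/choice[r rP] := rE.
have [i Ii|ms [ums cutms msP [F [uF FI sumF]]]] := CP I0 U r EU.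
  have [/andP[r0 rd] Ur _ _] := rP i Ii.
  by rewrite r0 (le_trans rd deltaD).
exists ms; split=> // [u ums'|].
  have [i Ii /andP[Dr rD]] := msP u ums'; have [/andP[r0 rd] _ tr _] := rP i Ii.
  by split; [exact: le_trans Dr rd | exact: le_lt_trans tr rD].
apply: le_trans sumF _; rewrite s_eta -mulrA ler_pM2l//.
apply: (@le_trans _ _ (\sum_(i <- F) (diam (U i) `^ s0 + e * 2^-1 ^+ i.+1))).
  by rewrite big_seq [leRHS]big_seq ler_sum// => i /FI/rP[].
rewrite big_split/= mulr_natl mulr2n lerD//; last first.
  by rewrite -mulr_sumr ger_pMr// sum_half_powers.
rewrite -lee_fin; apply: le_trans sumU; apply: esum_ge; exists [set` F].
  by split; [exact: finite_seq | move=> i /FI].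
rewrite -fsbig_seq// -sumEFin big_seq [leRHS]big_seq; apply: lee_sum => i /FI Ii.
by have [_ /ediam_fin -> _ _] := rP i Ii; rewrite poweR_EFin.
Qed.

End MoranCovers.

(** * Intermediate dimensions *)

Section IntermediateDimensions.
Variables (R : realType) (d : nat) (n : nat -> nat) (c : nat -> nat -> R).
Variable J : seq nat -> set 'rV[R]_d.
Hypothesis moranJ : moran_structure n c J.
Hypothesis ratio_lim :
  (fun k : nat => ln (min_ratio n c k) / ln (max_diam n J k.+1)) @ \oo --> (0 : R).

Local Notation D u := (diam (J u)).
Local Notation E := (moran_set n J).
Let D0 := moran_diam0_gt0 moranJ.

(** The bound [0 <= s'] records that the exponents of cut sets are nonnegative,
    which puts [s] in the range over which the dimensions are infima. *)
Lemma s_delta_cover theta s' s e : 0 < theta <= 1 -> s' < s -> 0 < e ->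
  exists2 Delta, 0 < Delta & forall delta, 0 < delta <= Delta ->
    s_delta n J theta delta < s' -> 0 <= s' /\ theta_cover theta s e delta E.
Proof.
move=> theta01 s's e0.
pose Delta0 := Num.min (2^-1 : R) (D [::] / 2).
have Delta00 : 0 < Delta0 by rewrite lt_min invr_gt0 ltr0n divr_gt0.
have small delta : 0 < delta <= Delta0 -> 0 < delta < 1 /\ delta < D [::].
  rewrite le_min => /andP[d0 /andP[d2 dD]]; rewrite d0.
  by have D0' := D0; split; rewrite /=; lra.
have [s'0|s'0] := leP 0 s'; last first.
  exists Delta0 => // delta /small[delta01 deltaD] lts.
  have := s_delta_ge0 moranJ ratio_lim theta01 delta01 deltaD.
  by move=> /le_lt_trans/(_ (lt_trans lts s'0)); rewrite ltxx.
have s'01 : 0 <= s' < s by rewrite s'0.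
have [Delta1 Delta10 cov] := cut_to_cover moranJ ratio_lim s'01 ltr01 e0.
exists (Num.min Delta0 Delta1); first by rewrite lt_min Delta00.
move=> delta /andP[delta0]; rewrite le_min => /andP[dD0 dD1] lts; split=> //.
have [|delta01 deltaD] := small delta; first by rewrite delta0.
have [ms [ums cutms msP] sum1] := s_delta_lt moranJ ratio_lim theta01 delta01 deltaD lts.
have [theta0 theta1] := andP theta01.
have tauE : theta_scale theta delta = delta `^ theta^-1.
  by rewrite /theta_scale gt_eqF.
apply: (cov _ _ ms) => //; first by rewrite delta0.
- by have [_ d1] := andP delta01; rewrite tauE ge1r_powR ?delta0 ?(ltW d1)// invf_ge1.
- by move=> u /msP[? ?]; rewrite tauE.
Qed.

Lemma s_delta_no_cover theta s0 s : 0 < theta <= 1 -> 0 <= s0 < s ->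
  exists e Delta : R, [/\ 0 < e, 0 < Delta & forall delta, 0 < delta <= Delta ->
    s < s_delta n J theta delta -> ~ theta_cover theta s0 e delta E].
Proof.
move=> theta01 s0s; have [C [Delta [C0 Delta0 CP]]] := cover_cut_sum moranJ ratio_lim s0s.
pose Delta1 := Num.min (2^-1 : R) (D [::] / 2).
have Delta10 : 0 < Delta1 by rewrite lt_min invr_gt0 ltr0n divr_gt0.
exists C^-1, (Num.min Delta1 Delta); split; first by rewrite invr_gt0.
  by rewrite lt_min Delta10.
move=> delta /andP[delta0]; rewrite !le_min => /andP[/andP[d2 dD] dDelta] lts.
move=> /CP[||ms [ums cutms msP]]; rewrite ?delta0 ?invr_gt0// divff ?gt_eqF//.
have [theta0 theta1] := andP theta01.
apply/negP; rewrite -ltNge.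
apply: (lt_s_delta moranJ ratio_lim theta01 _ _ lts); first by rewrite delta0/=; lra.
  by have D0' := D0; lra.
split=> // u /msP[? tauD]; split=> //.
by move: tauD; rewrite /theta_scale gt_eqF.
Qed.

(** At scale 0 there is no lower bound on the sizes, and the cut set can be taken
    to be a whole level of the tree. *)
Lemma s_level_cover s' s e delta : s' < s -> 0 < e -> 0 < delta ->
  (forall N, exists2 m, (N <= m)%N & s_level n c m < s') ->
  0 <= s' /\ theta_cover 0 s e delta E.
Proof.
move=> s's e0 delta0 freq.
have s'0 : 0 <= s'.
  have [m m0 /ltW] := freq 1%N; apply: le_trans.
  exact: (s_level_ge0 moranJ).
split=> //; have s'01 : 0 <= s' < s by rewrite s'0.
have B0 : 0 < D [::] `^ s' by rewrite powR_gt0.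
have [Delta Delta0 cov] := cut_to_cover moranJ ratio_lim s'01 B0 e0.
pose delta' := Num.min delta Delta.
have delta'0 : 0 < delta' by rewrite lt_min delta0.
apply: (@theta_cover0_mono _ _ _ _ delta'); first by rewrite ge_min lexx.
have [K KP] := diam_tends moranJ ratio_lim delta'0.
have [m] := freq K.+1; rewrite -ltnS => Km lts; have m0 : (0 < m)%N by case: (m) Km.
apply: (cov _ _ (level n m)).
- by rewrite delta'0 ge_min lexx orbT.
- by rewrite /theta_scale eqxx ltW.
- suff -> : [set` level n m] = words n m by exact: words_cut_set.
  by apply/seteqP; split=> u /mem_level.
- move=> u /mem_level um; have uw : finite_words n u by exists m.
  split; first by rewrite ltW// KP// (proj1 um) ltnW.
  rewrite /theta_scale eqxx; apply: (diam_gt0 moranJ).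
  case/lastP: u uw {um} => [//|u i] /finite_words_rcons[un _].
  by rewrite parent_rcons; exists (size u).
rewrite -[leRHS]mulr1; apply: le_trans (ler_wpM2l (ltW B0) (s_level_lt moranJ m0 lts)).
rewrite mulr_sumr big_seq [leRHS]big_seq ler_sum// => u /mem_level um.
have uw : finite_words n u by exists m.
by rewrite (diam_word moranJ uw) powRM ?(ltW D0) ?(ltW (word_ratio_gt0 moranJ uw)).
Qed.

Lemma s_level_no_cover s0 s N : 0 <= s0 < s ->
  (forall m, (N <= m)%N -> s < s_level n c m) ->
  exists e Delta : R, [/\ 0 < e, 0 < Delta & forall delta, 0 < delta <= Delta ->
    ~ theta_cover 0 s0 e delta E].
Proof.
move=> s0s evt; have [C [Delta [C0 Delta0 CP]]] := cover_cut_sum moranJ ratio_lim s0s.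
have [Delta1 Delta10 long] := small_diam_long moranJ N.+1.
have B0 : 0 < D [::] `^ s by rewrite powR_gt0.
exists (D [::] `^ s / 2 / C), (Num.min Delta1 Delta).
split; rewrite ?lt_min ?Delta10 ?divr_gt0// => delta /andP[delta0].
rewrite le_min => /andP[dD1 dD].
move=> /CP[||ms [ums cutms msP]]; rewrite ?delta0 ?divr_gt0//.
rewrite mulrC divfK ?gt_eqF//; apply/negP; rewrite -ltNge.
apply: (@lt_le_trans _ _ (D [::] `^ s)); first by rewrite ltr_pdivrMr// ltr_pMr// ltr1n.
apply: (cut_sum_ge moranJ (m0 := N.+1)) => // [m Nm|u us].
  by apply: (lt_s_level moranJ); [case: (m) Nm | exact/evt/ltnW].
have [Du _] := msP u us; apply: long (le_trans Du dD1).
exact: (proj1 cutms).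
Qed.

Lemma upper_dim_eq theta : 0 < theta <= 1 -> upper_intermediate_dim theta E =
  limf_esup (fun delta => (s_delta n J theta delta)%:E) 0^'+.
Proof.
move=> theta01; apply: ereal_inf_eq => [s s' /limf_esup_lt[V /at_right0_sub[a a0 aV] Vs'] s's|].
  have cov e := s_delta_cover theta01 s's (e := e).
  split=> [|e e0].
    have [Delta Delta0 DeltaP] := cov 1 ltr01.
    have m0 : 0 < Num.min a Delta by rewrite lt_min a0.
    have [||s'0 _] := DeltaP (Num.min a Delta).
    - by rewrite m0 ge_min lexx orbT.
    - by apply/Vs'/aV; rewrite m0 ge_min lexx.
    exact: le_trans s'0 (ltW s's).
  have [Delta Delta0 DeltaP] := cov e e0.
  exists (Num.min a Delta); first by rewrite lt_min a0.
  move=> delta /andP[delta0]; rewrite le_min => /andP[da dD].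
  have [||//] := DeltaP delta; first by rewrite delta0.
  by apply/Vs'/aV; rewrite delta0.
move=> s0 s [s00 covers] /lt_limf_esup freq s0s.
have s0s' : 0 <= s0 < s by rewrite s00.
have [e [Delta [e0 Delta0 nocov]]] := s_delta_no_cover theta01 s0s'.
have [Delta1 Delta10 cov] := covers e e0.
have m0 : 0 < Num.min Delta Delta1 by rewrite lt_min Delta0.
have [delta /=] := freq _ (at_right0_interval m0).
rewrite le_min => /andP[delta0 /andP[dD dD1]] lts.
by apply: (nocov delta) => //; [rewrite delta0 | apply: cov; rewrite delta0].
Qed.

Lemma lower_dim_eq theta : 0 < theta <= 1 -> lower_intermediate_dim theta E =
  limf_einf (fun delta => (s_delta n J theta delta)%:E) 0^'+.
Proof.
move=> theta01; apply: ereal_inf_eq => [s s' /limf_einf_lt freq s's|].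
  have cov e Delta : 0 < e -> 0 < Delta -> exists2 delta, 0 < delta <= Delta &
      0 <= s' /\ theta_cover theta s e delta E.
    move=> e0 Delta0.
    have [Delta1 Delta10 DeltaP] := s_delta_cover theta01 s's e0.
    have m0 : 0 < Num.min Delta Delta1 by rewrite lt_min Delta0.
    have [delta /=] := freq _ (at_right0_interval m0).
    rewrite le_min => /andP[delta0 /andP[dD dD1]] lts.
    by exists delta; [rewrite delta0 | apply: DeltaP => //; rewrite delta0].
  split=> [|e Delta e0 Delta0].
    have [_ _ [s'0 _]] := cov 1 1 ltr01 ltr01.
    exact: le_trans s'0 (ltW s's).
  by have [delta ? []] := cov e Delta e0 Delta0; exists delta.
move=> s0 s [s00 covers] /lt_limf_einf[V /at_right0_sub[a a0 aV] Vs] s0s.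
have s0s' : 0 <= s0 < s by rewrite s00.
have [e [Delta [e0 Delta0 nocov]]] := s_delta_no_cover theta01 s0s'.
have m0 : 0 < Num.min Delta a by rewrite lt_min Delta0.
have [delta /andP[delta0]] := covers e _ e0 m0.
rewrite le_min => /andP[dD da] cov.
by apply: (nocov delta) cov; [rewrite delta0 | apply/Vs/aV; rewrite delta0].
Qed.

Lemma dim0_eq : upper_intermediate_dim 0 E = s_star n c /\
  lower_intermediate_dim 0 E = s_star n c.
Proof.
have above s s' : (s_star n c < s'%:E)%E -> s' < s -> 0 <= s /\
    forall e delta, 0 < e -> 0 < delta -> theta_cover 0 s e delta E.
  move=> /limf_einf_lt freq s's.
  have {}freq N : exists2 m, (N <= m)%N & s_level n c m < s'.
    by apply: freq; exists N.
  split=> [|e delta e0 delta0].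
    have [s'0 _] := s_level_cover s's ltr01 ltr01 freq.
    exact: le_trans s'0 (ltW s's).
  by have [] := s_level_cover s's e0 delta0 freq.
have below s0 s : 0 <= s0 -> (s%:E < s_star n c)%E -> s0 < s ->
    exists e Delta : R, [/\ 0 < e, 0 < Delta & forall delta, 0 < delta <= Delta ->
    ~ theta_cover 0 s0 e delta E].
  move=> s00 /lt_limf_einf[V [N _ NV] Vs] s0s.
  by apply: (@s_level_no_cover _ s N) => [|m /NV/Vs//]; rewrite s00.
split; apply: ereal_inf_eq => [s s' Ls' s's|s0 s [s00 covers] sL s0s].
- have [s_ge0 cov] := above s s' Ls' s's; split=> // e e0.
  by exists 1 => // delta /andP[delta0 _]; exact: cov.
- have [e [Delta [e0 Delta0 nocov]]] := below s0 s s00 sL s0s.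
  have [Delta1 Delta10 cov] := covers e e0.
  have m0 : 0 < Num.min Delta Delta1 by rewrite lt_min Delta0.
  apply: (nocov (Num.min Delta Delta1)); first by rewrite m0 ge_min lexx.
  by apply: cov; rewrite m0 ge_min lexx orbT.
- have [s_ge0 cov] := above s s' Ls' s's; split=> // e Delta e0 Delta0.
  by exists Delta; [rewrite Delta0 lexx | exact: cov].
- have [e [Delta [e0 Delta0 nocov]]] := below s0 s s00 sL s0s.
  by have [delta dD] := covers e Delta e0 Delta0; exact: nocov.
Qed.

End IntermediateDimensions.

Theorem theorem1p4 (R : realType) (d : nat) (n : nat -> nat)
    (c : nat -> nat -> R) (J : seq nat -> set 'rV[R]_d)
    (moranJ : moran_structure n c J)
    (c_star : inf [set x : R | exists k j : nat, (j < n k)%N /\ x = c k j] = 0)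
    (ratio_lim : (fun k : nat => ln (min_ratio n c k) / ln (max_diam n J k.+1))
                   @ \oo --> (0 : R))
    (theta : R) (theta01 : 0 <= theta <= 1) :
  upper_intermediate_dim theta (moran_set n J) = s_upper n c J theta /\
  lower_intermediate_dim theta (moran_set n J) = s_lower n c J theta.
Proof.
have [->|theta0] := eqVneq theta 0.
  by rewrite /s_upper /s_lower eqxx; exact: (dim0_eq moranJ ratio_lim).
have theta01' : 0 < theta <= 1.
  by case/andP: theta01 => theta_ge0 ->; rewrite lt0r theta0 theta_ge0.
rewrite /s_upper /s_lower (negbTE theta0).
by split; [exact: (upper_dim_eq moranJ) | exact: (lower_dim_eq moranJ)].
Qed.
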